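(* Let $X_{t+1}=AX_t+Bu^t+w^t$, $t=0,1,2,\dots$, where $A$ is a real $n\times n$ matrix, $B$ is a real $n\times m$ matrix, $(A,B)$ is controllable, and $X_0$ and $w^t$, $t\ge0$, are i.i.d. $\mathbb{R}^n$-valued Gaussian random vectors with mean zero and positive variance. Let $$J(\underline\gamma)=\limsup_{T\to\infty}J_T(\underline\gamma),\qquad J_T(\underline\gamma)=\frac1T\mathbb{E}^{\underline\gamma}\Big[\sum_{t=0}^{T-1}X_t^TQX_t+(u^t)^TRu^t\Big],$$ where $Q\ge0$ and $R>0$ are real matrices of appropriate dimensions, and let the information structure be the fully observed classical one, $Y^t=X_t$. Let $\{\gamma_T^{t*}\}_T$ be a sequence of optimal policies for $\{J_T(\underline\gamma_T)\}_T$ with pointwise limit $\gamma_\infty^{t*}$ as $T\to\infty$. Then $u^{t*}=\lim_{T\to\infty}\gamma_T^{t*}(v^t)=\gamma_\infty^{t*}(v^t)$, $t\ge0$, is the optimal policy for $J(\underline\gamma)$.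
   Context: Each time stage $t$ is regarded as a separate decision maker applying $u^t\in\mathbb{R}^m$. Classical information structure: the information available at time $t$ contains all information available at earlier times (here, the measurements $Y^s=X_s$ for $s\le t$), and $u^t$ is a measurable function of this information. Writing $\zeta=(X_0^T,(w^0)^T,(w^1)^T,\dots)^T$, the Ho–Chu static reduction replaces the information at time $t$ by an equivalent exogenous observation $v^t=V^t=\tilde H_t\zeta$, with $\tilde H_t$ a real matrix, not affected by actions; policies are written $u^t=\gamma^t(v^t)$ with $\gamma^t$ measurable. $\underline\gamma=(\gamma^0,\gamma^1,\dots)$ and $\underline\gamma_T=(\gamma^0,\dots,\gamma^{T-1})$; $\mathbb{E}^{\underline\gamma}$ denotes expectation when these policies are used. A policy is optimal for $J_T$ (resp. $J$) if it attains the infimum of $J_T$ (resp. $J$) over admissible policies. $Q\ge0$ and $R>0$ mean positive semi-definite and positive definite. *)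

(* Defs.v *)
From HB Require Import structures.
From mathcomp Require Import all_boot all_order all_algebra.
From mathcomp Require Import all_classical all_reals all_analysis.

Set Implicit Arguments.
Unset Strict Implicit.
Unset Printing Implicit Defensive.

Import Order.TTheory GRing.Theory Num.Theory.
Import numFieldNormedType.Exports.

Local Open Scope classical_set_scope.
Local Open Scope ring_scope.

Notation borel T := (g_sigma_algebraType (@open T)).

Definition quad_form (K : realType) (n : nat) (M : 'M[K]_n) (x : 'cV[K]_n) : K :=
  (x^T *m M *m x) ord0 ord0.

Definition pos_semidef (K : realType) (n : nat) (M : 'M[K]_n) : Prop :=
  M^T = M /\ forall x : 'cV[K]_n, 0 <= quad_form M x.

Definition pos_def (K : realType) (n : nat) (M : 'M[K]_n) : Prop :=
  M^T = M /\ forall x : 'cV[K]_n, x != 0 -> 0 < quad_form M x.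

(* Kalman's condition: the block row [B, AB, ..., A^(n-1) B] has rank n. *)
Definition controllable (K : realType) (n m : nat)
    (A : 'M[K]_n) (B : 'M[K]_(n, m)) : Prop :=
  \rank (\mxrow_(k < n) (A ^+ k *m B)) = n.

Section Probability.
Context (d : measure_display) (Omega : measurableType d) (K : realType).
Variable (P : probability Omega K).

(* X ~ N(0, Sigma) with Sigma positive definite: every nonzero linear
   functional a^T X is univariate normal with variance a^T Sigma a. The second
   parameter of [normal_prob] is the standard deviation. *)
Definition centered_gaussian (n : nat) (Sigma : 'M[K]_n)
    (X : Omega -> 'cV[K]_n) : Prop :=
  [/\ pos_def Sigma,
      measurable_fun [set: Omega] (X : Omega -> borel 'cV[K]_n) &
      forall a : 'cV[K]_n, a != 0 ->
      forall E : set K, measurable E ->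
        P ((fun omega => (a^T *m X omega) ord0 ord0) @^-1` E) =
        normal_prob 0 (Num.sqrt (quad_form Sigma a)) E].

Definition mutually_independent (n : nat)
    (xi : nat -> Omega -> 'cV[K]_n) : Prop :=
  forall (s : seq nat) (E : nat -> set (borel 'cV[K]_n)),
    uniq s -> (forall k, measurable (E k)) ->
    P (\bigcap_(k in [set` s]) (xi k @^-1` E k)) =
    (\prod_(k <- s) P (xi k @^-1` E k))%E.

Definition iid_centered_gaussian (n : nat) (Sigma : 'M[K]_n)
    (xi : nat -> Omega -> 'cV[K]_n) : Prop :=
  mutually_independent xi /\ forall k, centered_gaussian Sigma (xi k).

End Probability.

(* The primitive random vector (X_0, w^0, w^1, ...): block 0 is X_0 and block
   t.+1 is w^t. *)
Definition primitive (Omega : Type) (K : realType) (n : nat)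
    (X0 : Omega -> 'cV[K]_n) (w : nat -> Omega -> 'cV[K]_n)
    (k : nat) : Omega -> 'cV[K]_n :=
  if k is t.+1 then w t else X0.

Section System.
Context (K : realType) (n m : nat) (p : nat -> nat).
Variables (A : 'M[K]_n) (B : 'M[K]_(n, m)).

(* [H t] is the nonzero part of the matrix of the static reduction at time t:
   what is known at time t involves X_0, w^0, ..., w^(t-1) only, so the columns
   acting on the later blocks of zeta vanish. *)
Variable H : forall t : nat, 'M[K]_(p t, \sum_(k < t.+1) n).

Definition policy := forall t : nat, 'cV[K]_(p t) -> 'cV[K]_m.

Definition admissible (g : policy) : Prop :=
  forall t, measurable_fun [set: borel 'cV[K]_(p t)]
    (g t : borel 'cV[K]_(p t) -> borel 'cV[K]_m).

Definition admissible_upto (T : nat) (g : policy) : Prop :=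
  forall t, (t < T)%N -> measurable_fun [set: borel 'cV[K]_(p t)]
    (g t : borel 'cV[K]_(p t) -> borel 'cV[K]_m).

Definition observation (zeta : nat -> 'cV[K]_n) (t : nat) : 'cV[K]_(p t) :=
  H t *m \mxcol_(k < t.+1) zeta k.

Definition action (g : policy) (zeta : nat -> 'cV[K]_n) (t : nat) : 'cV[K]_m :=
  g t (observation zeta t).

Fixpoint state (g : policy) (zeta : nat -> 'cV[K]_n) (t : nat) : 'cV[K]_n :=
  if t is s.+1
  then A *m state g zeta s + B *m action g zeta s + zeta s.+1
  else zeta 0%N.

(* v^t carries the same information as the classical fully observed one: under
   every admissible policy, v^t and (X_0, ..., X_t) determine each other. As
   v^t is linear in zeta, the case of null actions makes v^t and the
   uncontrolled states linear, hence Borel, functions of each other. *)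
Definition static_reduction : Prop :=
  forall (g : policy), admissible g ->
  forall (t : nat) (zeta zeta' : nat -> 'cV[K]_n),
    observation zeta t = observation zeta' t <->
    (forall s, (s <= t)%N -> state g zeta s = state g zeta' s).

Section Cost.
Context (d : measure_display) (Omega : measurableType d).
Variable (P : probability Omega K).
Variables (Q : 'M[K]_n) (R : 'M[K]_m) (xi : nat -> Omega -> 'cV[K]_n).

(* Depends on the components [g t] with t < T only. *)
Definition finite_cost (T : nat) (g : policy) : \bar K :=
  ((T%:R^-1)%:E *
   'E_P[fun omega => (\sum_(t < T)
          (quad_form Q (state g (xi^~ omega) t) +
           quad_form R (action g (xi^~ omega) t)))%R])%E.

Definition average_cost (g : policy) : \bar K :=
  limn_esup (fun T => finite_cost T g).

End Cost.

Definition optimal (adm : set policy) (J : policy -> \bar K) (g : policy) : Prop :=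
  adm g /\ J g = ereal_inf (J @` adm).

End System.

(* Main.v *)
Require Import Defs.
From HB Require Import structures.
From mathcomp Require Import all_boot all_order all_algebra.
From mathcomp Require Import all_classical all_reals all_analysis.
From mathcomp Require Import measurable_realfun ring lra.

Set Implicit Arguments.
Unset Strict Implicit.
Unset Printing Implicit Defensive.

Import Order.TTheory GRing.Theory Num.Theory.
Import numFieldNormedType.Exports.

Local Open Scope classical_set_scope.
Local Open Scope ring_scope.

(** The proof completes the square in the Bellman equation. Let [value k] be the
    iterates, started at 0, of the Riccati recursion. For weights S the function
    [cost_to_go S x u], which is x^T Q x + u^T R u + (A x + B u)^T S (A x + B u),
    differs from x^T (riccati S) x by a positive definite square in u + K x, so
    along any policy with square integrable actions T * J_T equals a constant,
    [optimal_cost T], plus the mean of a sum of nonnegative squares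
    ([bellman_cost]). The constant is the sum over k <= T of the means of
    xi^T (value k) xi. The cross terms between the new noise and A X_t + B u^t
    have mean zero because the noise is symmetric and independent of the past
    ([past_orthogonal]); a policy with finite cost has square integrable actions
    because R is positive definite.

    The observation v^t determines X_0, w^0, ..., w^(t-1) linearly
    ([static_reduction_injective]), so the linear feedback that annihilates all
    squares is an admissible policy. Hence optimal_cost T / T is the optimal
    value of J_T, and every optimal policy annihilates the squares almost surely:
    the Bellman equation holds along its trajectory ([optimal_bellman]).

    Controllability allows every state to be steered to 0 at a finite cost, which
    bounds the nondecreasing sequence of quadratic forms of [value k], and so
    [value k] converges to some S ([value_cvg]). As v^t is exogenous, the
    trajectories of the policies gamma T converge pointwise to the trajectory of
    gamma_inf. The Bellman equation, being continuous in all its data, passes to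
    the limit: with S on both sides it holds almost surely along gamma_inf.
    Telescoping it gives J_T(gamma_inf) <= (T + 1) / T * E[X_0^T S X_0]
    ([average_cost_le]), while the averages of the finite-horizon optimal values
    converge to E[X_0^T S X_0] by Cesaro's lemma, so no policy does better
    ([average_cost_ge]). *)

(** * Quadratic forms *)


Section QuadraticForms.
Variable K : realType.

Definition dot (n : nat) (x y : 'cV[K]_n) : K := (x^T *m y) ord0 ord0.

Lemma dotE n (x y : 'cV[K]_n) : dot x y = \sum_i x i ord0 * y i ord0.
Proof. by rewrite /dot mxE; apply: eq_bigr => i _; rewrite mxE. Qed.

Lemma dotC n (x y : 'cV[K]_n) : dot x y = dot y x.
Proof. by rewrite !dotE; apply: eq_bigr => i _; rewrite mulrC. Qed.

Lemma dotDl n (x y z : 'cV[K]_n) : dot (x + y) z = dot x z + dot y z.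
Proof. by rewrite /dot linearD /= mulmxDl mxE. Qed.

Lemma dotDr n (x y z : 'cV[K]_n) : dot x (y + z) = dot x y + dot x z.
Proof. by rewrite /dot mulmxDr mxE. Qed.

Lemma dotZl n a (x y : 'cV[K]_n) : dot (a *: x) y = a * dot x y.
Proof. by rewrite /dot linearZ /= -scalemxAl mxE. Qed.

Lemma dotZr n a (x y : 'cV[K]_n) : dot x (a *: y) = a * dot x y.
Proof. by rewrite dotC dotZl dotC. Qed.

Lemma dot_mulmxl m n (C : 'M[K]_(m, n)) x y : dot (C *m x) y = dot x (C^T *m y).
Proof. by rewrite /dot trmx_mul mulmxA. Qed.

Lemma dot_delta n (x : 'cV[K]_n) i : dot (delta_mx i ord0) x = x i ord0.
Proof. by rewrite /dot trmx_delta -rowE mxE. Qed.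

Lemma quad_form_dot n (M : 'M[K]_n) x : quad_form M x = dot x (M *m x).
Proof. by rewrite /quad_form /dot mulmxA. Qed.

Lemma quad_formDm n (M N : 'M[K]_n) x :
  quad_form (M + N) x = quad_form M x + quad_form N x.
Proof. by rewrite /quad_form mulmxDr mulmxDl mxE. Qed.

Lemma quad_formNm n (M : 'M[K]_n) x : quad_form (- M) x = - quad_form M x.
Proof. by rewrite /quad_form mulmxN mulNmx mxE. Qed.

Lemma quad_form0m n (x : 'cV[K]_n) : quad_form (0 : 'M[K]_n) x = 0.
Proof. by rewrite /quad_form mulmx0 mul0mx mxE. Qed.

Lemma quad_form0 n (M : 'M[K]_n) : quad_form M 0 = 0.
Proof. by rewrite /quad_form mulmx0 mxE. Qed.

Lemma quad_form_congr m n (M : 'M[K]_m) (C : 'M[K]_(m, n)) x :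
  quad_form (C^T *m M *m C) x = quad_form M (C *m x).
Proof. by rewrite /quad_form trmx_mul !mulmxA. Qed.

Lemma quad_formD n (M : 'M[K]_n) x y : M^T = M ->
  quad_form M (x + y) = quad_form M x + dot x (M *m y) *+ 2 + quad_form M y.
Proof.
move=> symM; rewrite !quad_form_dot mulmxDr !dotDl !dotDr.
have -> : dot y (M *m x) = dot x (M *m y) by rewrite dotC dot_mulmxl symM.
by rewrite mulr2n !addrA.
Qed.

Lemma quad_formZ n (M : 'M[K]_n) a x :
  quad_form M (a *: x) = a ^+ 2 * quad_form M x.
Proof. by rewrite !quad_form_dot -scalemxAr dotZl dotZr mulrA expr2. Qed.

Lemma quad_formE n (M : 'M[K]_n) x :
  quad_form M x = \sum_i \sum_j M i j * (x i ord0 * x j ord0).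
Proof.
rewrite quad_form_dot dotE; apply: eq_bigr => i _.
by rewrite mxE big_distrr; apply: eq_bigr => j _ /=; rewrite mulrCA.
Qed.

Lemma dot_mxE n (M : 'M[K]_n) i j :
  dot (delta_mx i ord0) (M *m delta_mx j ord0) = M i j.
Proof. by rewrite dot_delta -colE mxE. Qed.

(** Turns the convergence of quadratic forms into the entrywise convergence of
    their symmetric matrices. *)
Lemma polarization n (M : 'M[K]_n) i j : M^T = M ->
  M i j = (quad_form M (delta_mx i ord0 + delta_mx j ord0)
           - quad_form M (delta_mx i ord0) - quad_form M (delta_mx j ord0)) / 2.
Proof. by move=> symM; rewrite quad_formD // dot_mxE; field. Qed.

Lemma pos_def_ge0 n (M : 'M[K]_n) x : pos_def M -> 0 <= quad_form M x.
Proof.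
case=> _ pM; have [->|/pM/ltW//] := eqVneq x 0; by rewrite quad_form0.
Qed.

Lemma pos_semidef0 n : pos_semidef (0 : 'M[K]_n).
Proof. by split=> [|x]; rewrite ?trmx0 ?quad_form0m. Qed.

Lemma pos_def_unit n (M : 'M[K]_n) : pos_def M -> M \in unitmx.
Proof.
case=> symM pM; rewrite -row_free_unit; apply: inj_row_free => v vM0.
apply/eqP; apply: contraT => v0.
have := pM v^T; rewrite -(inj_eq trmx_inj) trmxK trmx0 => /(_ v0).
by rewrite /quad_form trmxK vM0 mul0mx mxE ltxx.
Qed.

Lemma pos_defD n (M N : 'M[K]_n) : pos_def M -> pos_semidef N -> pos_def (M + N).
Proof.
move=> [symM pM] [symN pN]; split=> [|x x0]; first by rewrite linearD /= symM symN.
by rewrite quad_formDm ltr_wpDr ?pM.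
Qed.

Lemma pos_semidef_congr m n (M : 'M[K]_m) (C : 'M[K]_(m, n)) :
  pos_semidef M -> pos_semidef (C^T *m M *m C).
Proof.
move=> [symM pM]; split=> [|x]; last by rewrite quad_form_congr.
by rewrite !trmx_mul trmxK symM mulmxA.
Qed.

(** Expands the nonnegative value of the form at b x - M[x] y, where b is the
    inner product of x and y. *)
Lemma quad_form_CauchySchwarz n (M : 'M[K]_n) x y : pos_def M ->
  dot x (M *m y) ^+ 2 <= quad_form M x * quad_form M y.
Proof.
move=> pM; have [->|x0] := eqVneq x 0.
  by rewrite quad_form0 mul0r -(scale0r (0 : 'cV[K]_n)) dotZl mul0r expr0n.
have px : 0 < quad_form M x by case: pM => _; exact.
set b := dot x (M *m y).
have := pos_def_ge0 (b *: x + (- quad_form M x) *: y) pM.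
rewrite quad_formD ?(proj1 pM) // !quad_formZ -scalemxAr dotZl dotZr -/b.
have -> : b ^+ 2 * quad_form M x + (b * (- quad_form M x * b)) *+ 2
    + (- quad_form M x) ^+ 2 * quad_form M y
  = quad_form M x * (quad_form M x * quad_form M y - b ^+ 2) by ring.
by rewrite pmulr_rge0 // subr_ge0.
Qed.

(** The coordinate x_i is the M-inner product of x with M^-1 e_i, so the
    Cauchy-Schwarz inequality bounds it. *)
Lemma pos_def_coercive n (M : 'M[K]_n) : pos_def M ->
  exists c : K, 0 <= c /\ forall (x : 'cV[K]_n) i, x i ord0 ^+ 2 <= c * quad_form M x.
Proof.
move=> pM; pose y i : 'cV[K]_n := invmx M *m delta_mx i ord0.
exists (\sum_i quad_form M (y i)); split.
  by apply: sumr_ge0 => i _; exact: pos_def_ge0.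
move=> x i; have -> : x i ord0 = dot x (M *m y i).
  by rewrite mulmxA mulmxV ?pos_def_unit // mul1mx dotC dot_delta.
rewrite [X in X ^+ 2]dotC dot_mulmxl (proj1 pM).
apply: le_trans (quad_form_CauchySchwarz _ _ pM) _; rewrite ler_wpM2r ?pos_def_ge0 //.
by rewrite (bigD1 i) //= lerDl sumr_ge0 // => j _; exact: pos_def_ge0.
Qed.

End QuadraticForms.

(** * Limits of matrices *)

Section Limits.
Variables (K : realType) (T : Type) (F : set_system T) (FF : Filter F).

Lemma cvg_sumr (I : Type) (r : seq I) (f : I -> T -> K) (l : I -> K) :
  (forall i, f i x @[x --> F] --> l i) ->
  (\sum_(i <- r) f i x) @[x --> F] --> \sum_(i <- r) l i.
Proof.
by move=> fl; apply: cvg_big => [|i _]; [exact: add_continuous|exact: fl].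
Qed.

Lemma cvg_mx m n (f : T -> 'M[K]_(m, n)) (l : 'M[K]_(m, n)) :
  f x @[x --> F] --> l <-> forall i j, f x i j @[x --> F] --> l i j.
Proof.
split=> [fl i j|fl].
  apply: (@cvg_comp _ _ _ f (fun M : 'M[K]_(m, n) => M i j) _ _ _ fl).
  exact: coord_continuous.
apply/cvg_ballP => e e0.
have : \forall x \near F, forall ij : 'I_m * 'I_n, ball (l ij.1 ij.2) e (f x ij.1 ij.2).
  by apply: filter_forall => ij; move/cvg_ballP: (fl ij.1 ij.2); exact.
by apply: filterS => x bx; split=> // i j; exact: (bx (i, j)).
Qed.

Lemma cvg_mulmx m n p (f : T -> 'M[K]_(m, n)) (g : T -> 'M[K]_(n, p))
    (a : 'M[K]_(m, n)) (b : 'M[K]_(n, p)) :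
  f x @[x --> F] --> a -> g x @[x --> F] --> b ->
  f x *m g x @[x --> F] --> a *m b.
Proof.
move=> /cvg_mx fa /cvg_mx gb; apply/cvg_mx => i j.
under eq_fun => x do rewrite mxE.
by rewrite mxE; apply: cvg_sumr => k; apply: cvgM.
Qed.

Lemma cvg_quad_form n (M : T -> 'M[K]_n) (f : T -> 'cV[K]_n)
    (S : 'M[K]_n) (l : 'cV[K]_n) :
  M x @[x --> F] --> S -> f x @[x --> F] --> l ->
  quad_form (M x) (f x) @[x --> F] --> quad_form S l.
Proof.
move=> MS fl.
have flT : (f x)^T @[x --> F] --> l^T.
  apply/cvg_mx => i j; rewrite mxE; under eq_fun => x do rewrite mxE.
  by move/cvg_mx: fl; exact.
by have /cvg_mx := cvg_mulmx (cvg_mulmx flT MS) fl; exact.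
Qed.

End Limits.

(** * The Riccati recursion *)

Section Riccati.
Variables (K : realType) (n m : nat).
Variables (A : 'M[K]_n) (B : 'M[K]_(n, m)) (Q : 'M[K]_n) (R : 'M[K]_m).

Definition stage_cost (x : 'cV[K]_n) (u : 'cV[K]_m) : K :=
  quad_form Q x + quad_form R u.

Definition cost_to_go (S : 'M[K]_n) (x : 'cV[K]_n) (u : 'cV[K]_m) : K :=
  stage_cost x u + quad_form S (A *m x + B *m u).

Definition input_weight (S : 'M[K]_n) : 'M[K]_m := R + B^T *m S *m B.

(** The feedback u = - K x minimizes [cost_to_go S x]. *)
Definition gain (S : 'M[K]_n) : 'M[K]_(m, n) :=
  invmx (input_weight S) *m (B^T *m S *m A).

(** Equals Q + A^T S A - A^T S B (R + B^T S B)^-1 B^T S A; the form with the gain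
    is manifestly symmetric and is the one that completing the square yields. *)
Definition riccati (S : 'M[K]_n) : 'M[K]_n :=
  Q + A^T *m S *m A - (gain S)^T *m input_weight S *m gain S.

Definition value (k : nat) : 'M[K]_n := iter k riccati 0.

Hypotheses (pQ : pos_semidef Q) (pR : pos_def R).

Lemma stage_cost_ge0 x u : 0 <= stage_cost x u.
Proof. by rewrite addr_ge0 ?(proj2 pQ) ?pos_def_ge0. Qed.

Lemma input_weight_pos_def S : pos_semidef S -> pos_def (input_weight S).
Proof. by move=> pS; apply: pos_defD => //; exact: pos_semidef_congr. Qed.

Lemma complete_square S x u : pos_semidef S ->
  cost_to_go S x u = quad_form (riccati S) x
    + quad_form (input_weight S) (u + gain S *m x).
Proof.
move=> pS; have pG := input_weight_pos_def pS.
rewrite /cost_to_go /stage_cost (quad_formD _ _ (proj1 pS)).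
rewrite (quad_formD _ _ (proj1 pG)).
rewrite (quad_formDm (Q + _)) (quad_formDm Q) quad_formNm !quad_form_congr.
have -> : input_weight S *m (gain S *m x) = B^T *m S *m A *m x.
  by rewrite mulmxA /gain mulmxA mulmxV ?mul1mx ?pos_def_unit.
rewrite (quad_formDm R _ u) quad_form_congr.
have -> : dot (A *m x) (S *m (B *m u)) = dot u (B^T *m S *m A *m x).
  rewrite dotC dot_mulmxl (proj1 pS) dot_mulmxl !mulmxA //.
ring.
Qed.

Lemma riccati_le S x u : pos_semidef S ->
  quad_form (riccati S) x <= cost_to_go S x u.
Proof.
move=> pS; rewrite complete_square // lerDl pos_def_ge0 //.
exact: input_weight_pos_def.
Qed.

Lemma riccati_gain S x : pos_semidef S ->
  cost_to_go S x (- (gain S *m x)) = quad_form (riccati S) x.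
Proof. by move=> pS; rewrite complete_square // addNr quad_form0 addr0. Qed.

Lemma riccati_semidef S : pos_semidef S -> pos_semidef (riccati S).
Proof.
move=> pS; split=> [|x]; last first.
  by rewrite -riccati_gain // addr_ge0 ?stage_cost_ge0 ?(proj2 pS).
have symG := proj1 (input_weight_pos_def pS).
rewrite /riccati; move: (input_weight S) (gain S) symG => G g symG.
by rewrite !(linearB, linearD) /= !trmx_mul !trmxK (proj1 pQ) (proj1 pS) symG !mulmxA.
Qed.

Lemma value_semidef k : pos_semidef (value k).
Proof. by elim: k => [|k IH]; [exact: pos_semidef0|exact: riccati_semidef]. Qed.

Lemma valueS k : value k.+1 = riccati (value k). Proof. by []. Qed.

(** A longer horizon only adds nonnegative costs: the optimal feedback for k + 2
    stages is a competitor in the problem with k + 1 stages. *)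
Lemma value_nondecreasing k x : quad_form (value k) x <= quad_form (value k.+1) x.
Proof.
elim: k x => [|k IH] x; first by rewrite quad_form0m (proj2 (value_semidef 1)).
rewrite [value k.+2]valueS -riccati_gain; last exact: value_semidef.
apply: le_trans (riccati_le _ (- (gain (value k.+1) *m x)) (value_semidef k)) _.
by rewrite lerD2l IH.
Qed.

(** If the controls u_(j-1), ..., u_0 steer x to 0 in j steps, their cost bounds
    the optimal cost over any horizon, since staying at 0 is free. Controls are
    numbered backwards so that the sum is the one of the Kalman matrix. *)
Lemma value_le_steering x j (u : nat -> 'cV[K]_m) :
  A ^+ j *m x + \sum_(k < j) (A ^+ k *m B) *m u k = 0 ->
  exists c, forall k, quad_form (value k) x <= c.
Proof.
elim: j x => [|j IH] x.
  rewrite big_ord0 addr0 expr0 mul1mx => ->.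
  by exists 0 => k; rewrite quad_form0.
rewrite big_ord_recr /= => ux0.
have /IH[c cP] : A ^+ j *m (A *m x + B *m u j) +
    \sum_(k < j) (A ^+ k *m B) *m u k = 0.
  rewrite -[RHS]ux0 mulmxDr !mulmxA -addrA exprSr; congr (_ + _).
  exact: addrC.
exists (stage_cost x (u j) + c) => k.
apply: le_trans (value_nondecreasing k x) _; rewrite valueS.
apply: le_trans (riccati_le _ (u j) (value_semidef k)) _.
by rewrite lerD2l.
Qed.

(** A right inverse of the Kalman matrix provides controls that steer x to 0. *)
Lemma value_bounded x : controllable A B ->
  exists c, forall k, quad_form (value k) x <= c.
Proof.
rewrite /controllable; set C := (X in \rank X) => rC.
have fC : row_free C by rewrite /row_free rC.
pose U := pinvmx C *m - (A ^+ n *m x).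
have CU : C *m U = - (A ^+ n *m x) by rewrite mulmxA mulmxVp ?mul1mx.
pose u k := if insub k is Some i then submxcol (U : 'cV_(\sum_(i < n) m)) i else 0.
apply: (@value_le_steering x n u).
have -> : \sum_(k < n) A ^+ k *m B *m u k = C *m U.
  rewrite -[in RHS](submxcolK U) mul_mxrow_mxcol; apply: eq_bigr => i _.
  by rewrite /u valK.
by rewrite CU subrr.
Qed.

(** The quadratic forms are nondecreasing and bounded, hence convergent;
    polarization transfers the convergence to the entries. *)
Lemma value_cvg : controllable A B ->
  exists S : 'M[K]_n, pos_semidef S /\ value k @[k --> \oo] --> S.
Proof.
move=> cAB.
have qcvg x : cvgn (fun k => quad_form (value k) x).
  apply: nondecreasing_is_cvgn.
    by apply/nondecreasing_seqP => k; exact: value_nondecreasing.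
  have [c cP] := value_bounded x cAB.
  by exists c => _ [k _ <-].
pose S := \matrix_(i, j) limn (fun k => value k i j).
have vcvg i j : value k i j @[k --> \oo] --> S i j.
  rewrite mxE; apply/cvg_ex; eexists.
  under eq_fun => k do rewrite polarization ?(proj1 (value_semidef k)) //.
  by apply: cvgMl; apply: cvgB; [apply: cvgB|]; exact: qcvg.
have vS : value k @[k --> \oo] --> S by apply/cvg_mx.
exists S; split => //; split.
  apply/matrixP => i j; rewrite !mxE; congr (limn _); apply/funext => k.
  by rewrite -{1}(proj1 (value_semidef k)) mxE.
move=> x.
have qS : quad_form (value k) x @[k --> \oo] --> quad_form S x.
  by apply: cvg_quad_form => //; exact: cvg_cst.
rewrite -(cvg_lim _ qS) //; apply: limr_ge; first by apply/cvg_ex; eexists; exact: qS.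
by apply: nearW => k; case: (value_semidef k).
Qed.

End Riccati.


(** * Borel measurability of column vectors *)

Section BorelMatrices.
Variable K : realType.

Lemma measurable_coord n (i : 'I_n) :
  measurable_fun [set: borel 'cV[K]_n] (fun x : 'cV[K]_n => x i ord0).
Proof.
apply: (measurability _ (RGenOpens.measurableE K)) => _ [_ [a [b ->] <-]].
rewrite setTI; apply: sub_sigma_algebra.
by apply: open_comp => [x _|]; [exact: coord_continuous|exact: interval_open].
Qed.

(** The Borel sets of column vectors are generated by the coordinates, because an
    open set is the union of the countably many rational boxes that it contains. *)
Lemma measurable_mxP d (T : measurableType d) n (f : T -> 'cV[K]_n) :
  measurable_fun [set: T] (f : T -> borel 'cV[K]_n) <->
  forall i, measurable_fun [set: T] (fun x => f x i ord0).
Proof.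
split=> [mf i|mf]; first exact: (measurableT_comp (measurable_coord i) mf).
apply: (@measurability _ _ _ _ _ (f : T -> borel _) (@open 'cV[K]_n)) => //.
move=> _ [U oU <-].
rewrite setTI.
pose box (qk : 'cV[rat]_n * nat) : set 'cV[K]_n :=
  [set v | forall i, ball (ratr (qk.1 i ord0) : K) qk.2.+1%:R^-1 (v i ord0)].
have -> : f @^-1` U = \bigcup_qk
    [set x | box qk `<=` U /\ box qk (f x)].
  apply/seteqP; split=> [x /= Ufx|x [qk _ [boxU /boxU]] //].
  have [e /= e0 eU] := (nbhs_ballP _ _).1 (open_nbhs_nbhs (conj oU Ufx)).
  (* the box around q of radius 1 / (k + 1) lies in the ball of radius 2 / (k + 1) *)
  have [k ke] : exists k : nat, k.+1%:R^-1 < e / 2.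
    near \oo => k; exists k; near: k.
    by apply: near_infty_natSinv_lt (PosNum (divr_gt0 e0 (ltr0n _ 2))).
  have k0 : 0 < k.+1%:R^-1 :> K by rewrite invr_gt0.
  have /choice[q qP] i : exists q : rat, ball (ratr q : K) k.+1%:R^-1 (f x i ord0).
    have [|q] :=
      @rat_in_itvoo K (f x i ord0 - k.+1%:R^-1) (f x i ord0 + k.+1%:R^-1).
      by move: k0; set r := _^-1 => k0; lra.
    rewrite in_itv /= => /andP[q1 q2]; exists q.
    rewrite /ball /= ltr_norml; move: q1 q2; set r := _^-1 => q1 q2.
    by apply/andP; split; lra.
  exists (\col_i q i, k) => //; split=> [v boxv|i]; last by rewrite mxE.
  apply: eU; split => // i j; rewrite (ord1 j).
  have := boxv i; rewrite /= mxE => bv.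
  apply: le_ball (ball_triangle (ball_sym (qP i)) bv).
  by move: ke => /=; set r := _^-1 => ke; lra.
apply: countable_bigcupT_measurable => // -[q k].
have [bU|bU] := pselect (box (q, k) `<=` U); last first.
  by rewrite (_ : [set x | _] = set0) //; apply/seteqP; split=> x // [].
rewrite (_ : [set x | _] = \bigcap_(i in [set: 'I_n])
    ((fun x => f x i ord0) @^-1` ball (ratr (q i ord0) : K) k.+1%:R^-1)); last first.
  by apply/seteqP; split=> [x [_ bx] i _|x bx]; [exact: bx|split=> // i; exact: bx].
apply: fin_bigcap_measurable => // i _.
rewrite -[X in measurable X]setTI; apply: mf => //; exact: measurable_ball.
Unshelve. all: by end_near. Qed.

Lemma measurable_mxD d (T : measurableType d) n (f g : T -> 'cV[K]_n) :
  measurable_fun [set: T] (f : T -> borel 'cV[K]_n) ->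
  measurable_fun [set: T] (g : T -> borel 'cV[K]_n) ->
  measurable_fun [set: T] ((fun x => f x + g x) : T -> borel 'cV[K]_n).
Proof.
move=> /measurable_mxP mf /measurable_mxP mg; apply/measurable_mxP => i.
by under eq_fun => x do rewrite mxE; exact: measurable_funD.
Qed.

Lemma measurable_mulmx d (T : measurableType d) m n (C : 'M[K]_(m, n))
    (f : T -> 'cV[K]_n) :
  measurable_fun [set: T] (f : T -> borel 'cV[K]_n) ->
  measurable_fun [set: T] ((fun x => C *m f x) : T -> borel 'cV[K]_m).
Proof.
move=> /measurable_mxP mf; apply/measurable_mxP => i.
under eq_fun => x do rewrite mxE.
by apply: measurable_sum => j; apply: measurable_funM.
Qed.

Lemma measurable_quad_form d (T : measurableType d) n (M : 'M[K]_n)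
    (f : T -> 'cV[K]_n) :
  measurable_fun [set: T] (f : T -> borel 'cV[K]_n) ->
  measurable_fun [set: T] (fun x => quad_form M (f x)).
Proof.
move=> /measurable_mxP mf; under eq_fun => x do rewrite quad_formE.
apply: measurable_sum => i; apply: measurable_sum => j.
by apply: measurable_funM => //; apply: measurable_funM.
Qed.

Lemma measurable_mx_cvg d (T : measurableType d) n
    (f : nat -> T -> 'cV[K]_n) (g : T -> 'cV[K]_n) :
  (forall k, measurable_fun [set: T] (f k : T -> borel 'cV[K]_n)) ->
  (forall x, f k x @[k --> \oo] --> g x) ->
  measurable_fun [set: T] (g : T -> borel 'cV[K]_n).
Proof.
move=> mf fg; apply/measurable_mxP => i.
apply: (@measurable_fun_cvg _ _ _ _ (fun k x => f k x i ord0)) => [k|x _].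
  by move: i; apply/measurable_mxP.
by move/cvg_mx: (fg x); exact.
Qed.

End BorelMatrices.


(** * The centered normal law *)

Section CenteredNormal.
Variables (K : realType) (s : K).
Hypothesis s0 : s != 0.

Lemma normal_pdfN x : normal_pdf 0 s (- x) = normal_pdf 0 s x.
Proof. by rewrite !normal_pdfE // /normal_fun !subr0 sqrrN. Qed.

(** The substitution x -> - x in the integral of the even density over half-lines
    identifies the law and its reflection on a generating pi-system. *)
Lemma normal_probN (E : set K) : measurable E ->
  normal_prob 0 s (-%R @^-1` E) = normal_prob 0 s E.
Proof.
move=> mE.
have mN : measurable_fun [set: K] (-%R : K -> K) by exact: oppr_measurable.
pose pN : {measure set (measurableTypeR K) -> \bar K} :=
  pushforward (normal_prob 0 s) (-%R : K -> measurableTypeR K).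
pose N := pN mN.
have g_cover : \bigcup_k `[- k%:R, +oo[%classic = [set: K].
  apply/seteqP; split => // x _; have [k xk] : exists k : nat, `|x| <= k%:R.
    by exists (Num.trunc `|x|).+1; exact/ltW/truncnS_gt.
  by exists k => //=; rewrite in_itv /= andbT lerNl (le_trans _ xk) // -normrN ler_norm.
rewrite -[LHS]/(N E).
pose M : {measure set (measurableTypeR K) -> \bar K} := normal_prob 0 s.
apply: (@measure_unique _ K (measurableTypeR K) (@RGenCInfty.G K)
  (fun k => `[- k%:R, +oo[%classic) _ _ _ g_cover N M) => //.
- exact: RGenCInfty.measurableE.
- move=> _ _ [x ->] [y ->]; exists (Num.max x y).
  by apply/seteqP; split=> z /=; rewrite !in_itv /= !andbT ge_max => /andP.
- by move=> k; eexists.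
- move=> _ [x ->]; rewrite /N /pN /= /pushforward.
  have -> : -%R @^-1` `[x, +oo[ = `]-oo, (- x)]%classic.
    by apply/seteqP; split=> z /=; rewrite !in_itv /= andbT lerNr.
  rewrite /normal_prob ge0_integration_by_substitutionNy.
  + by apply: eq_integral => z _ /=; rewrite normal_pdfN.
  + by apply: continuous_subspaceT; exact: continuous_normal_pdf.
  + by move=> z _; exact: normal_pdf_ge0.
- move=> k; apply: (@le_lt_trans _ _ 1%E); last exact: ltry.
  apply: (@probability_le1 _ _ _ (normal_prob 0 s)).
  by rewrite -[X in measurable X]setTI; apply: (mN).
Qed.

(** With y = x^2 / (4 s^2) the density is proportional to exp (- 2 y), and
    y exp (- y) <= 1 leaves exp (- y), proportional to the density of deviation
    sqrt 2 * s. *)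
Lemma sqr_normal_pdf_le : exists c, 0 <= c /\
  forall x, x ^+ 2 * normal_pdf 0 s x <= c * normal_pdf 0 (Num.sqrt 2 * s) x.
Proof.
have r0 : Num.sqrt 2 * s != 0 :> K by rewrite mulf_neq0 // gt_eqF // sqrtr_gt0.
exists (4 * s ^+ 2 * normal_peak s / normal_peak (Num.sqrt 2 * s)).
have s2 : 0 < s ^+ 2 by rewrite exprn_even_gt0.
have p1 := normal_peak_gt0 s0; have p2 := normal_peak_gt0 r0.
have c0 : 0 <= 4 * s ^+ 2 * normal_peak s.
  by rewrite mulr_ge0 ?(ltW p1) // mulr_ge0 ?(ltW s2).
split=> [|x]; first by rewrite divr_ge0 // ltW.
rewrite !normal_pdfE // /normal_fun !subr0 exprMn sqr_sqrtr //.
set y := x ^+ 2 / (4 * s ^+ 2).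
have -> : - x ^+ 2 / (s ^+ 2 *+ 2) = - y + - y by rewrite /y; field.
have -> : - x ^+ 2 / ((2 * s ^+ 2) *+ 2) = - y by rewrite /y; field.
have -> : x ^+ 2 * (normal_peak s * expR (- y + - y)) =
    4 * s ^+ 2 * normal_peak s * (y * expR (- y)) * expR (- y).
  by rewrite expRD /y; field.
rewrite [leRHS]mulrA divfK ?gt_eqF // ler_wpM2r ?expR_ge0 //.
rewrite ler_piMr //.
rewrite expRN ler_pdivrMr ?expR_gt0 // mul1r.
by have := expR_ge1Dx y; lra.
Qed.

(** [normal_prob] is given by its values on sets only, so integrals against it go
    through the Radon-Nikodym derivative, which is the density almost everywhere. *)
Lemma normal_square_integrable :
  (normal_prob 0 s).-integrable [set: K] (fun x => (x ^+ 2)%:E).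
Proof.
pose mu := @lebesgue_measure K; pose N := normal_prob 0 s.
have msq : measurable_fun [set: K] (fun x : K => (x ^+ 2)%:E).
  by apply/measurable_EFinP; exact: measurable_funX.
have numu : N `<< mu by exact: normal_prob_dominates.
apply/integrableP; split => //.
under eq_integral => x _ do rewrite gee0_abs ?lee_fin ?sqr_ge0 //.
have [c [c0 cP]] := sqr_normal_pdf_le.
have := Radon_Nikodym_SigmaFinite.change_of_variables numu
  (f := fun x => (x ^+ 2)%:E) _ measurableT msq.
move=> <-; last by move=> x; rewrite lee_fin sqr_ge0.
have fE : ae_eq mu setT (Radon_Nikodym_SigmaFinite.f N mu)
    (fun x => (normal_pdf 0 s x)%:E).
  apply: integral_ae_eq => //.
  - exact: Radon_Nikodym_SigmaFinite.f_integrable.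
  - by apply/measurable_EFinP; exact: measurable_normal_pdf.
  - by move=> E _ mE; rewrite -Radon_Nikodym_SigmaFinite.f_integral.
have mpdf r : measurable_fun [set: K] (fun x : K => (normal_pdf 0 r x)%:E).
  by apply/measurable_EFinP; exact: measurable_normal_pdf.
have mf : measurable_fun setT (Radon_Nikodym_SigmaFinite.f N mu).
  exact: measurable_int (Radon_Nikodym_SigmaFinite.f_integrable numu).
rewrite [ltLHS](_ : _ =
    (\int[mu]_x ((x ^+ 2)%:E * (normal_pdf 0 s x)%:E))%E); last first.
  apply: ae_eq_integral => //.
  - by apply: emeasurable_funM; [exact: msq|exact: mf].
  - by apply: emeasurable_funM; [exact: msq|exact: mpdf].
  - exact: (ae_eqe_mul2l (fun x : measurableTypeR K => (x ^+ 2)%:E) fE).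
apply: (@le_lt_trans _ _ (\int[mu]_x (c%:E * (normal_pdf 0 (Num.sqrt 2 * s) x)%:E)%E)%E).
  apply: ge0_le_integral => //.
  - by move=> x _; rewrite -EFinM lee_fin mulr_ge0 ?sqr_ge0 ?normal_pdf_ge0.
  - by apply: emeasurable_funM; [exact: msq|exact: mpdf].
  - by apply: emeasurable_funM; [exact: measurable_cst|exact: mpdf].
  - by move=> x _; rewrite -!EFinM lee_fin.
rewrite integralZl //; last exact: integrable_normal_pdf.
by rewrite integral_normal_pdf mule1 ltry.
Qed.

End CenteredNormal.


(** * Square integrable random vectors *)

Section SquareIntegrable.
Context d (Omega : measurableType d) (K : realType) (P : probability Omega K).
Implicit Types f g : Omega -> K.

Lemma Lfun2P f : measurable_fun [set: Omega] f ->
  P.-integrable [set: Omega] (EFin \o (fun x => f x ^+ 2)) -> f \in Lfun P 2%:E.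
Proof.
move=> mf /integrableP[_ If]; rewrite inE; apply/andP; split; rewrite inE //=.
rewrite /finite_norm unlock poweR_lty //; apply: le_lt_trans If.
apply: ge0_le_integral => //=.
- apply/measurable_EFinP; apply: (measurableT_comp (measurable_powR (2 : K))).
  exact: measurableT_comp.
- by apply/measurable_EFinP; apply: measurableT_comp => //; exact: measurable_funX.
- by move=> x _; rewrite lee_fin normrX powR_mulrn.
Qed.

Lemma Lfun2_measurable f : f \in Lfun P 2%:E -> measurable_fun [set: Omega] f.
Proof. by rewrite inE => /andP[+ _]; rewrite inE. Qed.

Lemma Lfun2_mul_integrable f g : f \in Lfun P 2%:E -> g \in Lfun P 2%:E ->
  P.-integrable [set: Omega] (EFin \o (fun x => f x * g x)).
Proof. by move=> lf lg; exact/Lfun1_integrable/Lfun2_mul_Lfun1. Qed.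

Lemma Lfun2_sum (I : Type) (r : seq I) (f : I -> Omega -> K) :
  (forall i, f i \in Lfun P 2%:E) ->
  (fun x => \sum_(i <- r) f i x) \in Lfun P 2%:E.
Proof.
move=> lf; have [L0 LD] := @Lfun_addr_closed _ _ _ P 2%:E ltac:(by rewrite lee_fin ler1n).
elim: r => [|i r IH]; first by under eq_fun => x do rewrite big_nil.
by under eq_fun => x do rewrite big_cons; exact: LD.
Qed.

Lemma Lfun2Z (a : K) f : f \in Lfun P 2%:E -> (fun x => a * f x) \in Lfun P 2%:E.
Proof.
move=> lf; under eq_fun => x do rewrite mulrC.
by apply: (Lfun_scale a _ lf); rewrite ler1n.
Qed.

Definition Lvec2 n (X : Omega -> 'cV[K]_n) : Prop :=
  forall i, (fun x => X x i ord0) \in Lfun P 2%:E.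

Lemma Lvec2D n (X Y : Omega -> 'cV[K]_n) : Lvec2 X -> Lvec2 Y ->
  Lvec2 (fun x => X x + Y x).
Proof.
move=> lX lY i; under eq_fun => x do rewrite mxE.
have [_ LD] := @Lfun_addr_closed _ _ _ P 2%:E ltac:(by rewrite lee_fin ler1n).
exact: LD.
Qed.

Lemma Lvec2_mulmx m n (C : 'M[K]_(m, n)) (X : Omega -> 'cV[K]_n) : Lvec2 X ->
  Lvec2 (fun x => C *m X x).
Proof.
move=> lX i; under eq_fun => x do rewrite mxE.
by apply: Lfun2_sum => j; exact: Lfun2Z.
Qed.

Lemma integrableDr f g :
  P.-integrable [set: Omega] (EFin \o f) -> P.-integrable [set: Omega] (EFin \o g) ->
  P.-integrable [set: Omega] (EFin \o (fun x => f x + g x)).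
Proof.
move=> If Ig; apply: (eq_integrable _ (fun x => (f x)%:E + (g x)%:E)%E) => //.
exact: integrableD.
Qed.

Lemma integrableBr f g :
  P.-integrable [set: Omega] (EFin \o f) -> P.-integrable [set: Omega] (EFin \o g) ->
  P.-integrable [set: Omega] (EFin \o (fun x => f x - g x)).
Proof.
move=> If Ig; apply: (eq_integrable _ (fun x => (f x)%:E - (g x)%:E)%E) => //.
exact: integrableB.
Qed.

Lemma integrableZlr (a : K) f : P.-integrable [set: Omega] (EFin \o f) ->
  P.-integrable [set: Omega] (EFin \o (fun x => a * f x)).
Proof.
move=> If; apply: (eq_integrable _ (fun x => a%:E * (f x)%:E)%E) => //.
exact: integrableZl.
Qed.

Lemma integrable_sumr (I : Type) (r : seq I) (f : I -> Omega -> K) :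
  (forall i, P.-integrable [set: Omega] (EFin \o f i)) ->
  P.-integrable [set: Omega] (EFin \o (fun x => \sum_(i <- r) f i x)).
Proof.
move=> If; apply: (eq_integrable _ (fun x => \sum_(i <- r) (f i x)%:E)%E) => //.
  by move=> x _ /=; rewrite sumEFin.
by apply: integrable_sum => // i _; exact: If.
Qed.

Lemma Rintegral_sum (I : Type) (r : seq I) (f : I -> Omega -> K) :
  (forall i, P.-integrable [set: Omega] (EFin \o f i)) ->
  \int[P]_x (\sum_(i <- r) f i x) = \sum_(i <- r) \int[P]_x f i x.
Proof.
move=> If; elim: r => [|i r IH].
  under eq_Rintegral => x _ do rewrite big_nil.
  by rewrite Rintegral_cst // mul0r big_nil.
under eq_Rintegral => x _ do rewrite big_cons.
by rewrite RintegralD //; [rewrite IH big_cons|exact: integrable_sumr].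
Qed.

Lemma Lvec2_dot_integrable n (X Y : Omega -> 'cV[K]_n) : Lvec2 X -> Lvec2 Y ->
  P.-integrable [set: Omega] (EFin \o (fun x => dot (X x) (Y x))).
Proof.
move=> lX lY; under eq_fun => x do rewrite dotE.
by apply: integrable_sumr => i; exact: Lfun2_mul_integrable.
Qed.

Lemma Lvec2_quad_integrable n (M : 'M[K]_n) (X : Omega -> 'cV[K]_n) : Lvec2 X ->
  P.-integrable [set: Omega] (EFin \o (fun x => quad_form M (X x))).
Proof.
move=> lX; under eq_fun => x do rewrite quad_form_dot.
by apply: Lvec2_dot_integrable => //; exact: Lvec2_mulmx.
Qed.

(** How finite quadratic costs, or the stationary Bellman equation, give square
    integrability of the actions. *)
Lemma Lvec2_coercive n (M : 'M[K]_n) (X : Omega -> 'cV[K]_n) (h : Omega -> K) :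
  pos_def M ->
  measurable_fun [set: Omega] (X : Omega -> borel 'cV[K]_n) ->
  P.-integrable [set: Omega] (EFin \o h) ->
  {ae P, forall x, quad_form M (X x) <= h x} ->
  Lvec2 X.
Proof.
move=> pM mX Ih Xh i; have [c [c0 cP]] := pos_def_coercive pM.
have mXi : measurable_fun [set: Omega] (fun x => X x i ord0) by move: i; exact/measurable_mxP.
apply: Lfun2P => //; apply/integrableP; split.
  by apply/measurable_EFinP; exact: measurable_funX.
have Ich : P.-integrable [set: Omega] (EFin \o (fun x => c * h x)) by exact: integrableZlr.
move/integrableP: (Ich) => [mch]; apply: le_lt_trans.
apply: ae_ge0_le_integral => //=.
- apply/measurable_EFinP; apply: measurableT_comp => //.
  exact: measurable_funX.
- by apply/measurable_EFinP; apply: measurableT_comp => //; exact/measurable_EFinP.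
- apply: filterS Xh => x Xh _; rewrite lee_fin ger0_norm ?sqr_ge0 //.
  apply: le_trans (cP _ _) _; apply: le_trans (ler_norm _).
  by rewrite ler_wpM2l.
Qed.

End SquareIntegrable.


(** * Independent centered Gaussian vectors *)

Section GaussianNoise.
Context d (Omega : measurableType d) (K : realType) (P : probability Omega K).
Variables (n : nat) (Sigma : 'M[K]_n) (xi : nat -> Omega -> 'cV[K]_n).
Hypothesis gauss : iid_centered_gaussian P Sigma xi.

Lemma noise_measurable k : measurable_fun [set: Omega] (xi k : Omega -> borel 'cV[K]_n).
Proof. by case: gauss => _ /(_ k) []. Qed.

Lemma dot_noise_measurable a k : measurable_fun [set: Omega] (fun x => dot a (xi k x)).
Proof.
have /measurable_mxP mxi := noise_measurable k.
under eq_fun => x do rewrite dotE.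
by apply: measurable_sum => i; apply: measurable_funM.
Qed.

Definition std (a : 'cV[K]_n) : K := Num.sqrt (quad_form Sigma a).

Lemma std_neq0 a : a != 0 -> std a != 0.
Proof.
case: gauss => _ /(_ 0%N) [[_ pS] _ _] a0.
by rewrite gt_eqF // sqrtr_gt0 pS.
Qed.

Lemma dot_noise_law a k (E : set K) : a != 0 -> measurable E ->
  P ((fun x => dot a (xi k x)) @^-1` E) = normal_prob 0 (std a) E.
Proof. by case: gauss => _ /(_ k) [_ _ +] a0 mE; apply. Qed.

Lemma dot_noise_symmetric a k (E : set K) : measurable E ->
  P ((fun x => - dot a (xi k x)) @^-1` E) = P ((fun x => dot a (xi k x)) @^-1` E).
Proof.
move=> mE; have [->|a0] := eqVneq a 0.
  rewrite (_ : (fun x => - _) = (fun x => dot 0 (xi k x))) //.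
  by apply/funext => x; rewrite /dot trmx0 mul0mx mxE oppr0.
rewrite dot_noise_law // -(normal_probN (std_neq0 a0)) // -(@dot_noise_law a k) //.
by rewrite -[X in measurable X]setTI; exact: oppr_measurable.
Qed.

Lemma dot_noise_sqr_integral a k : a != 0 ->
  (\int[P]_x ((dot a (xi k x)) ^+ 2)%:E =
   \int[normal_prob 0 (std a)]_x (x ^+ 2)%:E)%E.
Proof.
move=> a0.
have msq : measurable_fun [set: K] (fun x : K => (x ^+ 2)%:E).
  by apply/measurable_EFinP; exact: measurable_funX.
have mW := dot_noise_measurable a k.
pose L : {measure set (measurableTypeR K) -> \bar K} :=
  pushforward P ((fun x => dot a (xi k x)) : Omega -> measurableTypeR K).
transitivity (\int[L mW]_x (x ^+ 2)%:E)%E.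
  rewrite ge0_integral_pushforward //= => x _; by rewrite lee_fin sqr_ge0.
by apply: eq_measure_integral => E mE _; exact: dot_noise_law.
Qed.

Lemma dot_noise_Lfun2 a k : (fun x => dot a (xi k x)) \in Lfun P 2%:E.
Proof.
have mW := dot_noise_measurable a k.
apply: Lfun2P => //; have [->|a0] := eqVneq a 0.
  rewrite (_ : (fun _ => _) = cst 0); first exact: finite_measure_integrable_cst.
  by apply/funext => x; rewrite /dot trmx0 mul0mx mxE expr0n.
apply/integrableP; split.
  by apply/measurable_EFinP; exact: measurable_funX.
under eq_integral => x _ do rewrite /= ger0_norm ?sqr_ge0 //.
rewrite dot_noise_sqr_integral //.
have /integrableP[_] := normal_square_integrable (std_neq0 a0).
by under eq_integral => x _ do rewrite gee0_abs ?lee_fin ?sqr_ge0 //.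
Qed.

Lemma noise_Lvec2 k : Lvec2 P (xi k).
Proof.
move=> i; under eq_fun => x do rewrite -dot_delta; exact: dot_noise_Lfun2.
Qed.

(** Polarization reduces the mixed moments to the scalar laws of linear
    functionals, which do not depend on k. *)
Lemma noise_second_moment : exists S : 'M[K]_n, forall k i j,
  \int[P]_x (xi k x i ord0 * xi k x j ord0) = S i j.
Proof.
pose v a : K := fine (\int[normal_prob 0 (std a)]_x (x ^+ 2)%:E)%E.
pose e i : 'cV[K]_n := delta_mx i ord0.
have e0 i : e i != 0.
  apply/eqP => /matrixP /(_ i ord0); rewrite !mxE !eqxx /= => /eqP.
  by rewrite oner_eq0.
have ee0 i j : e i + e j != 0.
  apply/eqP => /matrixP /(_ i ord0); rewrite !mxE !eqxx /= andbT => /eqP.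
  by apply/negP; rewrite gt_eqF // ltr_wpDr.
have vE a k : a != 0 -> \int[P]_x (dot a (xi k x) ^+ 2) = v a.
  by move=> a0; rewrite /Rintegral dot_noise_sqr_integral.
have Iw a k : P.-integrable [set: Omega] (EFin \o (fun x => dot a (xi k x) ^+ 2)).
  exact/Lfun2_integrable_sqr/dot_noise_Lfun2.
exists (\matrix_(i, j) (2^-1 * (v (e i + e j) - v (e i) - v (e j)))) => k i j.
rewrite mxE -!(vE _ k) //.
rewrite -RintegralB // -RintegralB //; last exact: integrableBr.
rewrite -RintegralZl //; last by do 2!apply: integrableBr => //.
by apply: eq_Rintegral => x _; rewrite dotDl !dot_delta; field.
Qed.

Lemma noise_quad_mean : exists S : 'M[K]_n, forall k (M : 'M[K]_n),
  \int[P]_x quad_form M (xi k x) = \sum_i \sum_j M i j * S i j.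
Proof.
have [S SP] := noise_second_moment; exists S => k M.
under eq_Rintegral => x _ do rewrite quad_formE.
have Iij i j : P.-integrable [set: Omega]
    (EFin \o (fun x => xi k x i ord0 * xi k x j ord0)).
  by apply: Lfun2_mul_integrable; exact: noise_Lvec2.
have IM i j : P.-integrable [set: Omega]
    (EFin \o (fun x => M i j * (xi k x i ord0 * xi k x j ord0))).
  exact: integrableZlr.
rewrite Rintegral_sum; last by move=> i; exact: integrable_sumr.
apply: eq_bigr => i _; rewrite Rintegral_sum //; apply: eq_bigr => j _.
by rewrite RintegralZl // SP.
Qed.

(** Cylinders in the first t vectors: a pi-system that generates their
    sigma-algebra. *)
Definition past (t : nat) : set (set Omega) :=
  [set A | exists E : nat -> set (borel 'cV[K]_n),
     (forall k, measurable (E k)) /\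
     A = \bigcap_(k in [set` iota 0 t]) (xi k @^-1` E k)].

Lemma past_measurable t : past t `<=` measurable.
Proof.
move=> _ [E [mE ->]]; apply: bigcap_measurableType => k _.
by rewrite -[X in measurable X]setTI; apply: noise_measurable.
Qed.

Lemma past_setI t : setI_closed (past t).
Proof.
move=> _ _ [E [mE ->]] [F [mF ->]]; exists (fun k => E k `&` F k); split.
  by move=> k; exact: measurableI.
by rewrite -bigcapI.
Qed.

Lemma past_setT t : past t setT.
Proof.
exists (fun=> setT); split=> [k|]; first exact: measurableT.
by apply/seteqP; split.
Qed.

Lemma past_independent t A (F : set (borel 'cV[K]_n)) :
  past t A -> measurable F ->
  P (A `&` xi t @^-1` F) = (P A * P (xi t @^-1` F))%E.
Proof.
case=> E [mE ->] mF; case: gauss => ind _.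
pose E' k := if k == t then F else E k.
have mE' k : measurable (E' k) by rewrite /E'; case: ifP.
have E'E k : k \in iota 0 t -> E' k = E k.
  by rewrite mem_iota add0n /E' => /andP[_ kt]; rewrite ltn_eqF.
have := ind (iota 0 t.+1) E' (iota_uniq _ _) mE'.
rewrite -addn1 iotaD add0n /= cats1 -cats1 big_cat /= big_seq1.
rewrite {3}/E' eqxx (ind (iota 0 t) E (iota_uniq _ _) mE).
have -> : (\prod_(k <- iota 0 t) P (xi k @^-1` E' k) =
    \prod_(k <- iota 0 t) P (xi k @^-1` E k))%E.
  by apply: eq_big_seq => k kt; rewrite E'E.
move=> <-; congr (P _); apply/seteqP; split=> x /=.
  move=> [AE Ft] k /=; rewrite mem_cat inE => /orP[kt|/eqP ->].
    by rewrite /= E'E //; exact: AE.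
  by rewrite /E' eqxx.
move=> AE; split=> [k kt|]; last first.
  by have := AE t; rewrite /= mem_cat inE eqxx orbT /E' eqxx; exact.
by have := AE k; rewrite /= E'E // mem_cat kt; exact.
Qed.

(** The two sides, as functions of A, are finite measures that agree on the
    cylinders by independence and by the symmetry of the law. *)
Lemma past_dot_symmetric t a A (E : set K) : <<s past t >> A -> measurable E ->
  P (A `&` (fun x => dot a (xi t x)) @^-1` E) =
  P (A `&` (fun x => - dot a (xi t x)) @^-1` E).
Proof.
move=> sA mE.
have mdot : measurable_fun [set: borel 'cV[K]_n] (fun v : 'cV[K]_n => dot a v).
  under eq_fun => x do rewrite dotE.
  by apply: measurable_sum => i; apply: measurable_funM => //; exact: measurable_coord.
have mN : measurable_fun [set: borel 'cV[K]_n] (fun v : 'cV[K]_n => - dot a v).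
  exact: measurableT_comp mdot.
have mF1 : measurable ((fun x => dot a (xi t x)) @^-1` E).
  by rewrite -[X in measurable X]setTI; apply: dot_noise_measurable.
have mF2 : measurable ((fun x => - dot a (xi t x)) @^-1` E).
  by rewrite -[X in measurable X]setTI; apply: (measurableT_comp _ (dot_noise_measurable a t)).
apply: (@g_sigma_algebra_measure_unique _ K Omega (past t) (@past_measurable t)
  (fun=> setT) _ _ (mrestr P mF1) (mrestr P mF2)) => //.
- by move=> _; exact: past_setT.
- by apply/seteqP; split=> // x _; exists 0%N.
- exact: past_setI.
- move=> B pB; rewrite /mrestr.
  transitivity (P B * P ((fun x => dot a (xi t x)) @^-1` E))%E.
    apply: (past_independent pB (F := (fun v => dot a v) @^-1` E)).
    by rewrite -[X in measurable X]setTI; apply: mdot.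
  rewrite -dot_noise_symmetric //; symmetry.
  apply: (past_independent pB (F := (fun v => - dot a v) @^-1` E)).
  by rewrite -[X in measurable X]setTI; apply: mN.
- by move=> k; rewrite /= /mrestr setTI (le_lt_trans (probability_le1 _ mF1)) ?ltry.
Qed.

(** The pairs (f, a^T xi_t) and (f, - a^T xi_t) have the same law, since they give
    the same mass to rectangles; so the mean of the product is its own opposite. *)
Lemma past_orthogonal t a (f : Omega -> K) :
  measurable_fun [set: g_sigma_algebraType (past t)] f ->
  f \in Lfun P 2%:E ->
  \int[P]_x (f x * dot a (xi t x)) = 0.
Proof.
move=> pf lf; have mf := Lfun2_measurable lf.
pose W x := dot a (xi t x).
have mW : measurable_fun [set: Omega] W by exact: dot_noise_measurable.
have lW : W \in Lfun P 2%:E by exact: dot_noise_Lfun2.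
have mNW : measurable_fun [set: Omega] (fun x => - W x) by exact: measurableT_comp mW.
have IfW := Lfun2_mul_integrable lf lW.
pose T2 := (measurableTypeR K * measurableTypeR K)%type.
have m1 : measurable_fun [set: Omega] ((fun x => (f x, W x)) : Omega -> T2).
  exact: measurable_fun_pair.
have m2 : measurable_fun [set: Omega] ((fun x => (f x, - W x)) : Omega -> T2).
  exact: measurable_fun_pair.
pose L1 : {measure set T2 -> \bar K} :=
  pushforward P ((fun x => (f x, W x)) : Omega -> T2).
pose L2 : {measure set T2 -> \bar K} :=
  pushforward P ((fun x => (f x, - W x)) : Omega -> T2).
have L12 A : measurable A -> L1 m1 A = L2 m2 A.
  move=> mA.
  apply: (@measure_unique _ K T2
    [set A1 `*` A2 | A1 in measurable & A2 in measurable] (fun=> setT)) => //.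
  - exact: measurable_prod_measurableType.
  - move=> _ _ [X1 mX1 [X2 mX2 <-]] [Y1 mY1 [Y2 mY2 <-]].
    exists (X1 `&` Y1); first exact: measurableI.
    by exists (X2 `&` Y2); [exact: measurableI|rewrite setXI].
  - by move=> _; exists setT => //; exists setT => //; rewrite setXTT.
  - by apply/seteqP; split=> // x _; exists 0%N.
  - move=> _ [A1 mA1 [A2 mA2 <-]].
    have := @past_dot_symmetric t a (f @^-1` A1) A2 _ mA2; apply.
    by have := pf measurableT A1 mA1; rewrite setTI.
  - by move=> k; rewrite /= /pushforward preimage_setT probability_setT ltry.
pose g : T2 -> \bar K := fun z => (z.1 * z.2)%:E.
have mg : measurable_fun [set: T2] g.
  apply/measurable_EFinP; apply: measurable_funM; [exact: measurable_fst|exact: measurable_snd].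
have INfW : P.-integrable [set: Omega] (fun x => (f x * - W x)%:E).
  under eq_fun => x do rewrite mulrN -mulN1r; exact: integrableZlr.
have E12 : (\int[P]_x (f x * W x)%:E = \int[P]_x (f x * - W x)%:E)%E.
  have := @integral_pushforward _ _ _ T2 K _ m1 P setT g mg IfW measurableT.
  rewrite preimage_setT /= => <-.
  have := @integral_pushforward _ _ _ T2 K _ m2 P setT g mg INfW measurableT.
  rewrite preimage_setT /= => <-.
  by apply: eq_measure_integral => A mA _; exact: L12.
have : \int[P]_x (f x * W x) = - \int[P]_x (f x * W x).
  rewrite {1}/Rintegral E12 -mulN1r -RintegralZl //.
  by apply: congr1; apply: eq_integral => x _; rewrite mulrN mulN1r.
by move: (\int[P]_x _) => I; lra.
Qed.

End GaussianNoise.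


(** * The controlled system *)

Section Dynamics.
Variables (K : realType) (n m : nat) (p : nat -> nat).
Variables (A : 'M[K]_n) (B : 'M[K]_(n, m)).
Variable H : forall t : nat, 'M[K]_(p t, \sum_(k < t.+1) n).

(** Under null actions the states determine the noise, so an observation that
    determines the states has a trivial kernel. *)
Lemma static_reduction_injective : static_reduction A B H ->
  forall t, exists G : 'M[K]_(\sum_(k < t.+1) n, p t), G *m H t = 1%:M.
Proof.
move=> red t; exists (pinvmx (H t)); apply: mulVpmx.
suff : row_free (H t)^T by rewrite /row_free /row_full mxrank_tr.
apply: inj_row_free => v vH0.
pose z k : 'cV[K]_n := if insub k is Some i then submxcol v^T (i : 'I_t.+1) else 0.
have zE : \mxcol_(k < t.+1) z k = v^T.
  by rewrite -[RHS]submxcolK; apply: eq_mxcol => i; rewrite /z valK.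
have adm0 : @admissible K m p (fun _ _ => 0) by move=> s; exact: measurable_cst.
have obs0 : observation H z t = observation H (fun=> 0) t.
  rewrite /observation zE mxcol0 mulmx0 -[H t]trmxK -trmx_mul vH0.
  exact: trmx0.
have st0 s : state A B H (fun _ _ => 0) (fun=> 0) s = 0.
  by elim: s => //= s ->; rewrite /action !mulmx0 !addr0.
have st s : (s <= t)%N -> state A B H (fun _ _ => 0) z s = 0.
  by move=> st; rewrite ((red _ adm0 t z (fun=> 0)).1 obs0 s st).
have z0 k : (k <= t)%N -> z k = 0.
  case: k => [|k] kt; first exact: (st 0%N).
  by have := st k.+1 kt; rewrite /= /action mulmx0 addr0 (st k (ltnW kt)) mulmx0 add0r.
have : v^T = 0 by rewrite -zE (eq_mxcol (fun i : 'I_t.+1 => z0 i (ltn_ord i))) mxcol0.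
by move=> /(congr1 trmx); rewrite trmxK trmx0.
Qed.

Section Measurability.
Context d (T : measurableType d).
Variables (Z : nat -> T -> 'cV[K]_n).

Lemma observation_measurable t :
  (forall k, (k <= t)%N -> measurable_fun [set: T] (Z k : T -> borel 'cV[K]_n)) ->
  measurable_fun [set: T] ((fun x => observation H (Z^~ x) t) : T -> borel 'cV[K]_(p t)).
Proof.
move=> mZ; apply: measurable_mulmx; apply/measurable_mxP => i.
under eq_fun => x do rewrite mxE.
by move: (tagnat.sig2 i); apply/measurable_mxP; apply: mZ; rewrite -ltnS.
Qed.

Lemma action_measurable g t :
  measurable_fun [set: borel 'cV[K]_(p t)] (g t : borel 'cV[K]_(p t) -> borel 'cV[K]_m) ->
  (forall k, (k <= t)%N -> measurable_fun [set: T] (Z k : T -> borel 'cV[K]_n)) ->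
  measurable_fun [set: T] ((fun x => action H g (Z^~ x) t) : T -> borel 'cV[K]_m).
Proof. by move=> mg mZ; apply: (measurableT_comp mg); exact: observation_measurable. Qed.

Lemma state_measurable g t : admissible_upto t g ->
  (forall k, (k <= t)%N -> measurable_fun [set: T] (Z k : T -> borel 'cV[K]_n)) ->
  measurable_fun [set: T] ((fun x => state A B H g (Z^~ x) t) : T -> borel 'cV[K]_n).
Proof.
elim: t => [|t IH] mg mZ /=; first exact: mZ.
have mZt k : (k <= t)%N -> measurable_fun [set: T] (Z k : T -> borel 'cV[K]_n).
  by move=> kt; apply: mZ; exact: leqW.
apply: measurable_mxD; last exact: mZ.
apply: measurable_mxD; apply: measurable_mulmx.
  by apply: IH => // s st; apply: mg; exact: ltnW.
by apply: action_measurable => //; exact: mg.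
Qed.

End Measurability.

Lemma state_cvg (g : nat -> @policy K m p) (h : @policy K m p) (zeta : nat -> 'cV[K]_n) t :
  (forall s v, g N s v @[N --> \oo] --> h s v) ->
  state A B H (g N) zeta t @[N --> \oo] --> state A B H h zeta t.
Proof.
move=> gh; elim: t => [|t IH] /=; first exact: cvg_cst.
apply: cvgD; last exact: cvg_cst.
by apply: cvgD; apply: cvg_mulmx => //; [exact: cvg_cst|exact: cvg_cst|exact: gh].
Qed.

Section Feedback.
Variable F : nat -> 'M[K]_(m, n).

(** The state under u = - F_t x, written as a function of the noise alone because
    a policy has access to the observation and not to the state. *)
Fixpoint closed_loop (zeta : nat -> 'cV[K]_n) (t : nat) : 'cV[K]_n :=
  if t is s.+1
  then A *m closed_loop zeta s + B *m (- (F s *m closed_loop zeta s)) + zeta s.+1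
  else zeta 0%N.

Lemma closed_loop_eq zeta zeta' t :
  (forall k, (k <= t)%N -> zeta k = zeta' k) ->
  closed_loop zeta t = closed_loop zeta' t.
Proof.
elim: t => [|t IH] zz /=; first exact: zz.
by rewrite IH ?zz // => k kt; apply: zz; exact: leqW.
Qed.

Lemma closed_loop_measurable d (T : measurableType d) (Z : nat -> T -> 'cV[K]_n) t :
  (forall k, measurable_fun [set: T] (Z k : T -> borel 'cV[K]_n)) ->
  measurable_fun [set: T] ((fun x => closed_loop (Z^~ x) t) : T -> borel 'cV[K]_n).
Proof.
move=> mZ; elim: t => [|t IH] /=; first exact: mZ.
do 2!apply: measurable_mxD => //; apply: measurable_mulmx => //.
under eq_fun => x do rewrite -mulNmx; exact: measurable_mulmx.
Qed.

(** A left inverse of H_t recovers the noise up to time t from the observation;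
    replaying the closed loop on it gives the current state. *)
Lemma feedback_policy : static_reduction A B H ->
  exists g, admissible g /\
    forall zeta t, action H g zeta t = - (F t *m state A B H g zeta t).
Proof.
move=> red; pose G t := sval (cid (static_reduction_injective red t)).
have GH t : G t *m H t = 1%:M by rewrite /G; case: cid.
(* blocks after time t are unknown at time t; 0 stands for them *)
pose z t (v : 'cV[K]_(p t)) k : 'cV[K]_n :=
  if insub k is Some i then submxcol (G t *m v) (i : 'I_t.+1) else 0.
pose g t v := - (F t *m closed_loop (z t v) t).
have zE zeta t k : (k <= t)%N -> z t (observation H zeta t) k = zeta k.
  move=> kt; rewrite /z /observation mulmxA GH mul1mx insubT /=.
  exact: (mxcolK (fun i : 'I_t.+1 => zeta i) (Ordinal _)).
have gE zeta t : g t (observation H zeta t) = - (F t *m closed_loop zeta t).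
  by rewrite /g (@closed_loop_eq _ zeta) // => k; exact: zE.
have sE zeta t : state A B H g zeta t = closed_loop zeta t.
  by elim: t => //= t IH; rewrite /action gE IH.
exists g; split=> [t|zeta t]; last by rewrite /action gE sE.
rewrite /g; under eq_fun => v do rewrite -mulNmx.
apply: measurable_mulmx.
apply: (@closed_loop_measurable _ (borel 'cV[K]_(p t)) (fun k v => z t v k)) => k.
rewrite /z; case: insub => [i|]; last exact: measurable_cst.
under eq_fun => v do rewrite -submxcol_mul.
by apply: measurable_mulmx; exact: measurable_id.
Qed.

End Feedback.

End Dynamics.


(** * Finite-horizon costs *)

Section Cost.
Variables (K : realType) (n m : nat) (p : nat -> nat).
Variables (A : 'M[K]_n) (B : 'M[K]_(n, m)) (Q : 'M[K]_n) (R : 'M[K]_m).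
Variable H : forall t : nat, 'M[K]_(p t, \sum_(k < t.+1) n).
Context d (Omega : measurableType d) (P : probability Omega K).
Variables (Sigma : 'M[K]_n) (xi : nat -> Omega -> 'cV[K]_n).
Hypotheses (pQ : pos_semidef Q) (pR : pos_def R).
Hypothesis gauss : iid_centered_gaussian P Sigma xi.

Lemma past_noise_measurable t k : (k < t)%N ->
  measurable_fun [set: g_sigma_algebraType (past xi t)] (xi k : _ -> borel 'cV[K]_n).
Proof.
move=> kt _ E mE; rewrite setTI; apply: sub_sigma_algebra.
exists (fun j => if j == k then E else setT); split=> [j|].
  by case: ifP => // _; exact: measurableT.
apply/seteqP; split=> x /=.
  by move=> Ex j _ /=; case: eqP => // ->.
by move=> /(_ k); rewrite /= mem_iota eqxx; exact.
Qed.

Section FixedPolicy.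
Variable g : @policy K m p.
Let X t w := state A B H g (xi^~ w) t.
Let U t w := action H g (xi^~ w) t.

Lemma policy_state_measurable t : admissible_upto t g ->
  measurable_fun [set: Omega] (X t : Omega -> borel 'cV[K]_n).
Proof. by move=> ag; apply: state_measurable => // k _; exact: noise_measurable gauss k. Qed.

Lemma policy_action_measurable t : admissible_upto t.+1 g ->
  measurable_fun [set: Omega] (U t : Omega -> borel 'cV[K]_m).
Proof.
move=> ag; apply: action_measurable => [|k _]; first exact: ag.
exact: noise_measurable gauss k.
Qed.

Lemma policy_state_Lvec2 t : (forall s, (s < t)%N -> Lvec2 P (U s)) -> Lvec2 P (X t).
Proof.
elim: t => [|t IH] lU; first exact: noise_Lvec2 gauss 0%N.
apply: Lvec2D; last exact: noise_Lvec2 gauss t.+1.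
by apply: Lvec2D; apply: Lvec2_mulmx; [apply: IH => s st; apply: lU; exact: ltnW|exact: lU].
Qed.

(** A X_t + B u^t is a function of xi_0, ..., xi_t. *)
Lemma policy_noise_orthogonal t (V : 'M[K]_n) : admissible_upto t.+1 g ->
  (forall s, (s <= t)%N -> Lvec2 P (U s)) ->
  \int[P]_w dot (xi t.+1 w) (V *m (A *m X t w + B *m U t w)) = 0.
Proof.
move=> ag lU.
have lX : Lvec2 P (X t) by apply: policy_state_Lvec2 => s st; apply: lU; exact: ltnW.
pose Y w := V *m (A *m X t w + B *m U t w).
have lY : Lvec2 P Y.
  by apply: Lvec2_mulmx; apply: Lvec2D; apply: Lvec2_mulmx => //; exact: lU.
have pY : measurable_fun [set: g_sigma_algebraType (past xi t.+1)] (Y : _ -> borel 'cV[K]_n).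
  apply: measurable_mulmx; apply: measurable_mxD; apply: measurable_mulmx.
    apply: (@state_measurable _ _ _ _ A B H _ (g_sigma_algebraType (past xi t.+1)) xi).
      by move=> s st; apply: ag; exact: ltnW.
    by move=> k kt; exact: past_noise_measurable.
  apply: (@action_measurable _ _ _ _ H _ (g_sigma_algebraType (past xi t.+1)) xi).
    exact: ag.
  by move=> k kt; exact: past_noise_measurable.
under eq_Rintegral => w _ do rewrite dotE.
rewrite Rintegral_sum => [|i]; last first.
  by apply: Lfun2_mul_integrable; [exact: noise_Lvec2 gauss _ i|exact: lY].
apply: big1 => i _.
under eq_Rintegral => w _ do rewrite mulrC -(dot_delta (xi t.+1 w)).
apply: (@past_orthogonal _ _ _ _ _ _ _ gauss t.+1 (delta_mx i ord0) (fun w => Y w i ord0));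
  last exact: lY.
by move: i; apply/measurable_mxP.
Qed.

Lemma one_step_cost t (V : 'M[K]_n) : V^T = V -> admissible_upto t.+1 g ->
  (forall s, (s <= t)%N -> Lvec2 P (U s)) ->
  \int[P]_w stage_cost Q R (X t w) (U t w) + \int[P]_w quad_form V (X t.+1 w) =
  \int[P]_w cost_to_go A B Q R V (X t w) (U t w) + \int[P]_w quad_form V (xi t.+1 w).
Proof.
move=> symV ag lU.
have lX : Lvec2 P (X t) by apply: policy_state_Lvec2 => s st; apply: lU; exact: ltnW.
have lUt : Lvec2 P (U t) by exact: lU.
pose Y w := A *m X t w + B *m U t w.
have lY : Lvec2 P Y by apply: Lvec2D; apply: Lvec2_mulmx.
have lxi := noise_Lvec2 gauss t.+1.
have Is : P.-integrable [set: Omega] (EFin \o (fun w => stage_cost Q R (X t w) (U t w))).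
  by apply: integrableDr; exact: Lvec2_quad_integrable.
have IY : P.-integrable [set: Omega] (EFin \o (fun w => quad_form V (Y w))).
  exact: Lvec2_quad_integrable.
have Ixi : P.-integrable [set: Omega] (EFin \o (fun w => quad_form V (xi t.+1 w))).
  exact: Lvec2_quad_integrable.
have Id : P.-integrable [set: Omega] (EFin \o (fun w => dot (xi t.+1 w) (V *m Y w))).
  by apply: Lvec2_dot_integrable => //; exact: Lvec2_mulmx.
have Id2 : P.-integrable [set: Omega] (EFin \o (fun w => 2 * dot (xi t.+1 w) (V *m Y w))).
  exact: integrableZlr.
have -> : \int[P]_w quad_form V (X t.+1 w) =
    \int[P]_w quad_form V (Y w) + \int[P]_w quad_form V (xi t.+1 w).
  transitivity (\int[P]_w (quad_form V (Y w) + quad_form V (xi t.+1 w)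
      + 2 * dot (xi t.+1 w) (V *m Y w))).
    apply: eq_Rintegral => w _; rewrite /X /= -/(X t w) -/(U t w) -/(Y w).
    rewrite quad_formD // [dot (Y w) _]dotC dot_mulmxl symV; ring.
  rewrite RintegralD //; last exact: integrableDr.
  by rewrite RintegralD // RintegralZl // policy_noise_orthogonal // mulr0 addr0.
by rewrite addrA; congr (_ + _); rewrite -RintegralD.
Qed.

(** Serves twice: with V_t = value (T - t) it computes the finite-horizon cost, and
    with a constant V the cost along the stationary Bellman equation. *)
Lemma telescoped_cost (V : nat -> 'M[K]_n) T : (forall t, (V t)^T = V t) ->
  admissible_upto T g ->
  (forall s, (s < T)%N -> Lvec2 P (U s)) ->
  \sum_(t < T) \int[P]_w stage_cost Q R (X t w) (U t w)
    + \int[P]_w quad_form (V T) (X T w) =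
  \sum_(t < T.+1) \int[P]_w quad_form (V t) (xi t w) +
  \sum_(t < T) \int[P]_w (cost_to_go A B Q R (V t.+1) (X t w) (U t w)
                          - quad_form (V t) (X t w)).
Proof.
move=> symV; elim: T => [|T IH] ag lU.
  by rewrite !big_ord0 big_ord1 addr0 add0r.
have agT : admissible_upto T g by move=> s sT; apply: ag; exact: ltnW.
have lUT s : (s < T)%N -> Lvec2 P (U s) by move=> sT; apply: lU; exact: ltnW.
have lX : Lvec2 P (X T) by exact: policy_state_Lvec2.
have lUt : Lvec2 P (U T) by exact: lU.
have IV := Lvec2_quad_integrable (V T) lX.
have Ic : P.-integrable [set: Omega]
    (EFin \o (fun w => cost_to_go A B Q R (V T.+1) (X T w) (U T w))).
  apply: integrableDr; first by apply: integrableDr; exact: Lvec2_quad_integrable.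
  by apply: Lvec2_quad_integrable; apply: Lvec2D; exact: Lvec2_mulmx.
rewrite big_ord_recr /= -addrA one_step_cost //.
rewrite [\sum_(t < T.+2) _]big_ord_recr [X in _ = _ + X]big_ord_recr /=.
rewrite RintegralB //.
have := IH agT lUT; lra.
Qed.

Lemma finite_costE T : (forall s, (s < T)%N -> Lvec2 P (U s)) ->
  finite_cost A B H P Q R xi T g =
  (T%:R^-1 * \sum_(t < T) \int[P]_w stage_cost Q R (X t w) (U t w))%:E.
Proof.
move=> lU.
have Is (t : 'I_T) : P.-integrable [set: Omega]
    (EFin \o (fun w => stage_cost Q R (X t w) (U t w))).
  apply: integrableDr; apply: Lvec2_quad_integrable; last exact: lU.
  by apply: policy_state_Lvec2 => s st; apply: lU; exact: ltn_trans (ltn_ord t).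
rewrite /finite_cost EFinM; congr (_ * _)%E.
rewrite unlock -(Rintegral_sum _ Is) /Rintegral fineK //.
by apply: integrable_fin_num => //; exact: integrable_sumr.
Qed.

(** A finite mean of the nonnegative total cost bounds the mean of u^T R u. *)
Lemma finite_cost_Lvec2 T : (0 < T)%N -> admissible_upto T g ->
  (finite_cost A B H P Q R xi T g < +oo)%E ->
  forall s, (s < T)%N -> Lvec2 P (U s).
Proof.
move=> T0 ag; rewrite /finite_cost unlock => fin s sT.
pose h w := \sum_(t < T) stage_cost Q R (X t w) (U t w).
have mX t : (t < T)%N -> measurable_fun [set: Omega] (X t : Omega -> borel 'cV[K]_n).
  by move=> tT; apply: policy_state_measurable => r rt; apply: ag; exact: ltn_trans tT.
have mU t : (t < T)%N -> measurable_fun [set: Omega] (U t : Omega -> borel 'cV[K]_m).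
  by move=> tT; apply: policy_action_measurable => r rt; apply: ag; exact: leq_trans tT.
have mh : measurable_fun [set: Omega] h.
  apply: measurable_sum => t; apply: measurable_funD; apply: measurable_quad_form.
    exact: mX.
  exact: mU.
have h0 w : 0 <= h w by apply: sumr_ge0 => t _; exact: stage_cost_ge0.
have Ih : P.-integrable [set: Omega] (EFin \o h).
  apply/integrableP; split; first exact/measurable_EFinP.
  under eq_integral => w _ do rewrite /= ger0_norm //.
  rewrite ltey; apply/eqP => hoo; move: fin.
  rewrite -[X in (_ * X)%E]/(\int[P]_w (h w)%:E)%E hoo gt0_muley ?ltxx //.
  by rewrite lte_fin invr_gt0 ltr0n.
apply: (Lvec2_coercive pR (mU s sT) Ih); apply: nearW => w.
rewrite /h (bigD1 (Ordinal sT)) //= -addrA addrCA lerDl addr_ge0 //.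
  by case: pQ.
by apply: sumr_ge0 => t _; exact: stage_cost_ge0.
Qed.

End FixedPolicy.

(** Minimal value of T * J_T; the noise xi_t enters with T - t stages to go. *)
Definition optimal_cost T : K :=
  \sum_(t < T.+1) \int[P]_w quad_form (value A B Q R (T - t)) (xi t w).

(** The excess over optimality of the action taken at time t. *)
Let bellman_gap g T t w :=
  quad_form (input_weight B R (value A B Q R (T - t.+1)))
    (action H g (xi^~ w) t
     + gain A B R (value A B Q R (T - t.+1)) *m state A B H g (xi^~ w) t).

Lemma bellman_gapE g T t w : (t < T)%N -> bellman_gap g T t w =
  cost_to_go A B Q R (value A B Q R (T - t.+1)) (state A B H g (xi^~ w) t)
    (action H g (xi^~ w) t)
  - quad_form (value A B Q R (T - t)) (state A B H g (xi^~ w) t).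
Proof.
move=> tT; rewrite complete_square //; last exact: value_semidef.
have -> : (T - t = (T - t.+1).+1)%N by rewrite subnS prednK // subn_gt0.
by rewrite -valueS addrC addKr.
Qed.

Lemma bellman_gap_ge0 g T t w : 0 <= bellman_gap g T t w.
Proof.
by apply: pos_def_ge0; apply: input_weight_pos_def => //; exact: value_semidef.
Qed.

Lemma bellman_cost g T : admissible_upto T g ->
  (forall s, (s < T)%N -> Lvec2 P (fun w => action H g (xi^~ w) s)) ->
  finite_cost A B H P Q R xi T g =
  (T%:R^-1 * (optimal_cost T + \sum_(t < T) \int[P]_w bellman_gap g T t w))%:E.
Proof.
move=> ag lU; rewrite finite_costE //; congr (_ * _)%:E.
have symV t : (value A B Q R (T - t))^T = value A B Q R (T - t).
  by case: (value_semidef A B pQ pR (T - t)).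
have := telescoped_cost symV ag lU.
rewrite subnn; under eq_Rintegral => w _ do rewrite quad_form0m.
rewrite Rintegral_cst // mul0r addr0 => ->; congr (_ + _).
by apply: eq_bigr => t _; apply: eq_Rintegral => w _; rewrite bellman_gapE.
Qed.

Lemma optimal_cost_le g T : (0 < T)%N -> admissible_upto T g ->
  ((T%:R^-1 * optimal_cost T)%:E <= finite_cost A B H P Q R xi T g)%E.
Proof.
move=> T0 ag; have [->|foo] := eqVneq (finite_cost A B H P Q R xi T g) +oo%E.
  exact: leey.
have lU := finite_cost_Lvec2 T0 ag; rewrite ltey in lU.
rewrite bellman_cost //; last exact: lU.
rewrite lee_fin ler_wpM2l ?invr_ge0 // lerDl sumr_ge0 // => t _.
by apply: Rintegral_ge0 => w _; exact: bellman_gap_ge0.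
Qed.

Lemma optimal_cost_attained T : static_reduction A B H -> exists g,
  admissible g /\
  finite_cost A B H P Q R xi T g = (T%:R^-1 * optimal_cost T)%:E.
Proof.
move=> red.
have [g [ag gE]] := feedback_policy (fun t => gain A B R (value A B Q R (T - t.+1))) red.
exists g; split=> //.
have lU s : Lvec2 P (fun w => action H g (xi^~ w) s).
  elim/ltn_ind: s => s IH; under eq_fun => w do rewrite gE -mulNmx.
  by apply: Lvec2_mulmx; apply: policy_state_Lvec2.
rewrite bellman_cost //.
rewrite [X in _ + X]big1 ?addr0 // => t _.
under eq_Rintegral => w _ do rewrite /bellman_gap gE addNr quad_form0.
by rewrite Rintegral_cst // mul0r.
Qed.

(** The gaps are nonnegative and their means sum to 0, as the optimal value of
    J_T is optimal_cost T / T. *)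
Lemma optimal_bellman g T : static_reduction A B H -> (0 < T)%N ->
  optimal (admissible_upto T) (finite_cost A B H P Q R xi T) g ->
  {ae P, forall w, forall t, (t < T)%N ->
    cost_to_go A B Q R (value A B Q R (T - t.+1)) (state A B H g (xi^~ w) t)
      (action H g (xi^~ w) t)
    = quad_form (value A B Q R (T - t)) (state A B H g (xi^~ w) t)}.
Proof.
move=> red T0 [ag optg].
have [h [ah hE]] := optimal_cost_attained T red.
have gle : (finite_cost A B H P Q R xi T g <= (T%:R^-1 * optimal_cost T)%:E)%E.
  rewrite optg -hE; apply: ereal_inf_lbound; exists h => // t _; exact: ah.
have lU := finite_cost_Lvec2 T0 ag (le_lt_trans gle (ltry _)).
have lX t : (t < T)%N -> Lvec2 P (fun w => state A B H g (xi^~ w) t).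
  by move=> tT; apply: policy_state_Lvec2 => s st; apply: lU; exact: ltn_trans tT.
have Igap (t : 'I_T) : P.-integrable [set: Omega] (EFin \o bellman_gap g T t).
  apply: Lvec2_quad_integrable; apply: Lvec2D; first exact: lU.
  by apply: Lvec2_mulmx; exact: lX.
have gap0 (t : 'I_T) : \int[P]_w bellman_gap g T t w = 0.
  move: gle; rewrite bellman_cost // lee_fin ler_pM2l ?invr_gt0 ?ltr0n //.
  rewrite gerDl => gle; apply/eqP; rewrite eq_le; apply/andP; split; last first.
    by apply: Rintegral_ge0 => w _; exact: bellman_gap_ge0.
  apply: le_trans gle; rewrite (bigD1 t) //= lerDl sumr_ge0 // => s _.
  by apply: Rintegral_ge0 => w _; exact: bellman_gap_ge0.
have aet (t : nat) : {ae P, forall w, (t < T)%N -> bellman_gap g T t w = 0}.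
  have [tT|tT] := ltnP t T; last by apply: nearW.
  have [+ _] := @ae_eq_integral_abs _ _ _ P _ measurableT (EFin \o bellman_gap g T t)
    (measurable_int _ (Igap (Ordinal tT))).
  move=> gap_ae; apply: filterS (gap_ae _) => [w /(_ I) /= [gw] _ //|].
  under eq_integral => w _ do rewrite gee0_abs ?lee_fin ?bellman_gap_ge0 //.
  have fin := integrable_fin_num measurableT (Igap (Ordinal tT)).
  by apply/eqP; rewrite -fine_eq0 //; apply/eqP; exact: gap0 (Ordinal tT).
apply: filterS (ae_foralln aet) => w gapw t tT.
by apply/eqP; rewrite -subr_eq0 -bellman_gapE // gapw.
Qed.

End Cost.


(** * Average costs and the limit policy *)

Lemma limn_esup_le (K : realType) (u v : nat -> \bar K) :
  (forall k, (u k <= v k)%E) -> (limn_esup u <= limn_esup v)%E.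
Proof.
move=> uv; rewrite !limn_esup_lim; apply: lee_lim; [exact: is_cvg_esups..|].
apply: nearW => k; apply: ge_ereal_sup => _ [j kj <-].
by apply: le_trans (uv j) _; apply: ereal_sup_ubound; exists j.
Qed.

Section AverageCost.
Variables (K : realType) (n m : nat) (p : nat -> nat).
Variables (A : 'M[K]_n) (B : 'M[K]_(n, m)) (Q : 'M[K]_n) (R : 'M[K]_m).
Variable H : forall t : nat, 'M[K]_(p t, \sum_(k < t.+1) n).
Context d (Omega : measurableType d) (P : probability Omega K).
Variables (Sigma : 'M[K]_n) (xi : nat -> Omega -> 'cV[K]_n).
Hypotheses (pQ : pos_semidef Q) (pR : pos_def R).
Hypothesis gauss : iid_centered_gaussian P Sigma xi.
Variable S : 'M[K]_n.
Hypotheses (pS : pos_semidef S) (vS : value A B Q R k @[k --> \oo] --> S).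

(** With c_k the mean of xi^T (value k) xi, J_T is at least (T + 1) / T times the
    mean of c_0, ..., c_T, and c_k converges. *)
Lemma average_cost_ge g : admissible g ->
  ((\int[P]_w quad_form S (xi 0%N w))%:E <= average_cost A B H P Q R xi g)%E.
Proof.
move=> ag; have [C CP] := noise_quad_mean gauss.
pose c k := \int[P]_w quad_form (value A B Q R k) (xi 0%N w).
have c0 k : 0 <= c k.
  by apply: Rintegral_ge0 => w _; case: (value_semidef A B pQ pR k).
have cS : c k @[k --> \oo] --> \int[P]_w quad_form S (xi 0%N w).
  under eq_fun => k do rewrite /c CP.
  rewrite CP; apply: cvg_sumr => i; apply: cvg_sumr => j.
  by apply: cvgMr_tmp; move/cvg_mx: vS; exact.
have cT T : optimal_cost A B Q R P xi T = series c T.+1.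
  rewrite /series /= big_mkord (reindex_inj rev_ord_inj) /=.
  by apply: eq_bigr => t _; rewrite /c !CP subSS.
have mean_le T : ((arithmetic_mean c T)%:E <= finite_cost A B H P Q R xi T g)%E.
  case: T => [|T].
    rewrite (finite_costE _ _ _ _ gauss) // lee_fin big_ord0 mulr0 /arithmetic_mean /series /=.
    rewrite big_nat1 /c; under eq_Rintegral => w _ do rewrite quad_form0m.
    by rewrite Rintegral_cst // mul0r mulr0.
  apply: le_trans (optimal_cost_le A B H pQ pR gauss (ltn0Sn T) (fun t _ => ag t)).
  rewrite lee_fin cT /arithmetic_mean /= ler_wpM2r ?sumr_ge0 //.
  by rewrite lef_pV2 ?posrE ?ltr0n // ler_nat.
apply: le_trans (limn_esup_le mean_le).
have /cvg_limn_einf_sup[_ ->] // : (arithmetic_mean c T)%:E @[T --> \oo] -->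
    (\int[P]_w quad_form S (xi 0%N w))%:E.
by apply: cvg_EFin; [exact: nearW|exact: cesaro].
Qed.

(** The telescoped cost has no gap terms, and dropping the nonnegative terminal
    term E[X_T^T S X_T] leaves T * J_T <= (T + 1) * E[xi_0^T S xi_0]. *)
Lemma average_cost_le g : admissible g ->
  (forall t, {ae P, forall w,
    cost_to_go A B Q R S (state A B H g (xi^~ w) t) (action H g (xi^~ w) t)
    = quad_form S (state A B H g (xi^~ w) t)}) ->
  (average_cost A B H P Q R xi g <= (\int[P]_w quad_form S (xi 0%N w))%:E)%E.
Proof.
move=> ag gS; have [C CP] := noise_quad_mean gauss.
set c := \int[P]_w quad_form S (xi 0%N w).
have lU s : Lvec2 P (fun w => action H g (xi^~ w) s).
  elim/ltn_ind: s => s IH.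
  have lX : Lvec2 P (fun w => state A B H g (xi^~ w) s).
    exact: @policy_state_Lvec2 _ _ _ _ A B H _ _ _ _ _ gauss g s IH.
  apply: (Lvec2_coercive pR _ (Lvec2_quad_integrable S lX)).
    by apply: (policy_action_measurable _ gauss) => t _; exact: ag.
  apply: filterS (gS s) => w <-.
  rewrite /cost_to_go /stage_cost addrAC lerDr addr_ge0 //; first by case: pQ.
  by case: pS.
have lX s : Lvec2 P (fun w => state A B H g (xi^~ w) s).
  by apply: (policy_state_Lvec2 _ _ gauss) => t _; exact: lU.
have gap0 t : \int[P]_w (cost_to_go A B Q R S (state A B H g (xi^~ w) t)
    (action H g (xi^~ w) t) - quad_form S (state A B H g (xi^~ w) t)) = 0.
  have Is := Lvec2_quad_integrable S (Lvec2D (Lvec2_mulmx A (lX t)) (Lvec2_mulmx B (lU t))).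
  have Igap := integrableBr (integrableDr (integrableDr
    (Lvec2_quad_integrable Q (lX t)) (Lvec2_quad_integrable R (lU t))) Is)
    (Lvec2_quad_integrable S (lX t)).
  rewrite /Rintegral (ae_eq_integral (cst 0%E)) //; first by rewrite integral0.
    exact: measurable_int Igap.
  by apply: filterS (gS t) => w gSw _ /=; rewrite gSw subrr.
have upper T : (finite_cost A B H P Q R xi T g <= (T%:R^-1 * (T.+1%:R * c))%:E)%E.
  rewrite (finite_costE _ _ _ _ gauss) // lee_fin ler_wpM2l ?invr_ge0 //.
  have agT : admissible_upto T g by move=> t _; exact: ag.
  have := telescoped_cost A B Q R gauss (fun=> proj1 pS) agT (fun s _ => lU s).
  rewrite [X in _ = _ + X]big1 => [|t _]; last exact: gap0.
  rewrite addr0.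
  under [X in _ = X]eq_bigr => t _ do rewrite CP -(CP 0%N).
  rewrite sumr_const card_ord -/c mulr_natl => <-.
  by rewrite lerDl; apply: Rintegral_ge0 => w _; case: pS.
apply: le_trans (limn_esup_le upper) _.
have cvgc : (T%:R^-1 * (T.+1%:R * c))%:E @[T --> \oo] --> c%:E.
  apply: cvg_EFin; first exact: nearW.
  rewrite -cvg_shiftS /=.
  have -> : (fun T => T.+1%:R^-1 * (T.+2%:R * c)) = (fun T => c + c * harmonic T).
    apply/funext => T; rewrite /harmonic /= -[T.+2%:R]natr1; field.
    by rewrite nat1r pnatr_eq0.
  have : c + c * harmonic T @[T --> \oo] --> c + c * 0.
    by apply: cvgD; [exact: cvg_cst|apply: cvgMl_tmp; exact: cvg_harmonic].
  by rewrite mulr0 addr0.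
by case: (cvg_limn_einf_sup cvgc) => _ ->.
Qed.

End AverageCost.

Theorem theorem16 (K : realType) (n m : nat)
  (A : 'M[K]_n) (B : 'M[K]_(n, m)) (Q : 'M[K]_n) (R : 'M[K]_m)
  (d : measure_display) (Omega : measurableType d) (P : probability Omega K)
  (X0 : Omega -> 'cV[K]_n) (w : nat -> Omega -> 'cV[K]_n) (Sigma : 'M[K]_n)
  (p : nat -> nat) (H : forall t : nat, 'M[K]_(p t, \sum_(k < t.+1) n))
  (gamma : nat -> policy K m p) (gamma_inf : policy K m p) :
  controllable A B ->
  pos_semidef Q ->
  pos_def R ->
  iid_centered_gaussian P Sigma (primitive X0 w) ->
  static_reduction A B H ->
  (forall T : nat, (0 < T)%N ->
     optimal (admissible_upto T)
       (finite_cost A B H P Q R (primitive X0 w) T) (gamma T)) ->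
  (forall (t : nat) (v : 'cV[K]_(p t)),
     gamma T t v @[T --> \oo] --> gamma_inf t v) ->
  (forall (t : nat) (omega : Omega),
     action H (gamma T) ((primitive X0 w)^~ omega) t @[T --> \oo] -->
     action H gamma_inf ((primitive X0 w)^~ omega) t) /\
  optimal (@admissible K m p)
    (average_cost A B H P Q R (primitive X0 w)) gamma_inf.
Proof.
move=> cAB pQ pR gauss red optg glim.
split=> [t omega|]; first exact: glim.
set xi := primitive X0 w in gauss optg *.
have [S [pS vS]] := value_cvg pQ pR cAB.
(* gamma T t is measurable for T > t only, hence the shift by t + 1 *)
have adm : admissible gamma_inf.
  move=> t; apply: (@measurable_mx_cvg _ _ (borel 'cV[K]_(p t)) _
      (fun N => gamma (t.+1 + N)%N t)) => [N|v].
    by apply: (optg _ _).1; rewrite ?ltn_addr.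
  have := glim t v; rewrite -(cvg_shiftn t.+1).
  by under eq_fun => N do rewrite addnC.
split=> //.
(* the horizon N + t + 1 leaves N + 1 stages to go at time t *)
have bellman t : {ae P, forall w,
    cost_to_go A B Q R S (state A B H gamma_inf (xi^~ w) t)
      (action H gamma_inf (xi^~ w) t)
    = quad_form S (state A B H gamma_inf (xi^~ w) t)}.
  have opt_ae (N : nat) := optimal_bellman pQ pR gauss red (ltn0Sn N) (optg _ (ltn0Sn N)).
  apply: filterS (ae_foralln opt_ae) => w0 eqN.
  pose x N := state A B H (gamma (N + t.+1)%N) (xi^~ w0) t.
  pose u N := action H (gamma (N + t.+1)%N) (xi^~ w0) t.
  have shift (V : ptopologicalType) (f : nat -> V) (l : V) k :
      f N @[N --> \oo] --> l -> f (N + k)%N @[N --> \oo] --> l.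
    by rewrite -(cvg_shiftn k).
  have xlim : x N @[N --> \oo] --> state A B H gamma_inf (xi^~ w0) t.
    by apply: (shift _ (fun N => state A B H (gamma N) (xi^~ w0) t)); exact: state_cvg.
  have ulim : u N @[N --> \oo] --> action H gamma_inf (xi^~ w0) t.
    by apply: (shift _ (fun N => action H (gamma N) (xi^~ w0) t)); exact: glim.
  have eqx N : cost_to_go A B Q R (value A B Q R N) (x N) (u N)
      = quad_form (value A B Q R N.+1) (x N).
    have := eqN (N + t)%N t; rewrite -addnS ltn_addl // => /(_ isT).
    by rewrite addnK (_ : N + t.+1 - t = N.+1)%N // addnS -addSn addnK.
  have vS1 : value A B Q R N.+1 @[N --> \oo] --> S.
    by have := shift _ _ _ 1%N vS; under eq_fun => k do rewrite addn1.
  have costlim : cost_to_go A B Q R (value A B Q R N) (x N) (u N) @[N --> \oo] -->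
      cost_to_go A B Q R S (state A B H gamma_inf (xi^~ w0) t)
        (action H gamma_inf (xi^~ w0) t).
    apply: cvgD; first by apply: cvgD; apply: cvg_quad_form => //; exact: cvg_cst.
    apply: cvg_quad_form => //.
    by apply: cvgD; apply: cvg_mulmx => //; exact: cvg_cst.
  rewrite (funext eqx) in costlim.
  by apply: (cvg_unique _ costlim) => //; exact: cvg_quad_form.
apply/eqP; rewrite eq_le; apply/andP; split; last first.
  by apply: ereal_inf_lbound; exists gamma_inf.
apply: le_trans (average_cost_le pQ pR gauss pS adm bellman) _.
apply/ereal_infP => _ [g ag <-].
exact: (average_cost_ge H pQ pR gauss vS ag).
Qed.
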